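(* Let $W,W'\subset\mathbb Z^+$, let $l\ge 0$ be an integer and let $\nu,\nu'$ be compositions with $|\nu|=|\nu'|=n$. Then $$\{T_l(M):M\in\mathcal M^{U}_{WW'}(\nu;\nu'),\ \ell^-_{WW'}(M)\le l\}$$ is a basis of $\Pi(\nu')\,C_n(U(l))\,\Pi(\nu)$ (i.e. the elements $T_l(M)$ indexed by these multisets $M$ are linearly independent and span).
   Context: A composition $\nu=(\nu_1,\nu_2,\ldots)$ is a finite sequence of nonnegative integers, $|\nu|=\sum\nu_i$. It determines a set partition of $\{1,\ldots,|\nu|\}$ into blocks $S(\nu)_i=\{j:\sum_{k<i}\nu_k<j\le\sum_{k\le i}\nu_k\}$. For $S\subset\{1,\ldots,n\}$, in $\mathbb C[S_n]$ put $E_S=\sum_\pi\mathrm{sgn}(\pi)\pi$ and $H_S=\sum_\pi\pi$, the sums over $\pi\in S_n$ fixing every $x\notin S$. Set $\Pi(\nu)=\prod_{i\in W}E_{S(\nu)_i}\prod_{i\notin W}H_{S(\nu)_i}$ and $\Pi(\nu')=\prod_{i\in W'}E_{S(\nu')_i}\prod_{i\notin W'}H_{S(\nu')_i}$. $C_n(U(l))$ is the algebra of operators on $(\mathbb C^l)^{\otimes n}$ commuting with all $U^{\otimes n}$, $U\in U(l)$. $T_l:\mathbb C[S_n]\to C_n(U(l))$ is the algebra homomorphism given by the permutation of tensor factors, $T_l(\pi)(v_1\otimes\cdots\otimes v_n)=v_{\pi^{-1}(1)}\otimes\cdots\otimes v_{\pi^{-1}(n)}$, and $\Pi(\nu')C_n(U(l))\Pi(\nu)=\{T_l(\Pi(\nu'))\,A\,T_l(\Pi(\nu)):A\in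 C_n(U(l))\}$. A finite multiset $M$ on $\mathbb Z^+\times\mathbb Z^+$ is $(W,W')$-compatible if $(i,j)$ has multiplicity at most $1$ whenever exactly one of $i\in W$, $j\in W'$ holds. $\mathcal M^U_{WW'}(\nu;\nu')$ is the set of $(W,W')$-compatible multisets in which each $i$ appears $\nu_i$ times as a first coordinate and $\nu'_i$ times as a second coordinate (with multiplicity). For such $M$, choose $\pi\in S_n$ such that $M$ is the multiset of pairs $(i,j)$, one for each $k\in\{1,\ldots,n\}$, with $k\in S(\nu)_i$, $\pi(k)\in S(\nu')_j$; then $T_l(M):=T_l(\Pi(\nu')\,\pi\,\Pi(\nu))$, which is independent of the choice of $\pi$ up to sign (fix any choice). A $(W,W')$-decreasing sequence is a sequence $(x_i,y_i)$ with $x_i\le x_{i+1}$, $y_i\ge y_{i+1}$, where $x_i=x_{i+1}$ only if $x_i\in W$ and $y_i=y_{i+1}$ only if $y_i\in W'$. $\ell^-_{WW'}(M)$ is the length of the longest $(W,W')$-decreasing sequence of elements of $M$, each element used at most as often as its multiplicity. *)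

(* Defs.v *)
From HB Require Import structures.
From mathcomp Require Import all_boot all_order all_algebra all_fingroup.
From mathcomp Require Import finmap multiset complex.
From mathcomp Require Import boolp classical_sets reals.

Set Implicit Arguments.
Unset Strict Implicit.
Unset Printing Implicit Defensive.

Import Order.TTheory GRing.Theory Num.Theory.
Local Open Scope ring_scope.

(* Conventions. Positive integers are coded by [nat], the integer [i >= 1] being
   represented by [i.-1]; in particular the parts of a composition [nu : seq nat]
   are [nth 0 nu i] with [i] counted from 0, and [{1, ..., n}] is ['I_n]. *)

Section GroupAlgebra.
Variables (C : fieldType) (n : nat).

(* [a s] is the coefficient of the permutation [s]. A new type is needed because
   [{ffun _ -> _}] already carries the pointwise product. *)
Definition grpalg : Type := {ffun 'S_n -> C^o}.

HB.instance Definition _ := Vector.copy grpalg {ffun 'S_n -> C^o}.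

Definition gperm (s : 'S_n) : grpalg := [ffun t => (t == s)%:R].

Implicit Types a b c : grpalg.

(* Permutations multiply as functions, right to left: [s t = s \o t], which is
   [t * s] for the product of ['S_n] in the library. *)
Definition gmul a b : grpalg :=
  [ffun u => \sum_(p : 'S_n * 'S_n | (p.2 * p.1)%g == u) a p.1 * b p.2].

Lemma gmulE a b :
  gmul a b = \sum_s \sum_t (a s * b t) *: gperm (t * s)%g.
Proof.
apply/ffunP => u; rewrite ffunE pair_big /= big_mkcond sum_ffunE.
apply: eq_bigr => -[s t] _ /=; rewrite !ffunE eq_sym.
by case: eqP => _; rewrite /GRing.scale /= ?mulr1 ?mulr0.
Qed.

Lemma gpermE a : a = \sum_s a s *: gperm s.
Proof.
apply/ffunP => u; rewrite sum_ffunE (bigD1 u) //= big1 => [|s su].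
  by rewrite !ffunE eqxx /GRing.scale /= mulr1 addr0.
by rewrite !ffunE eq_sym (negPf su) /GRing.scale /= mulr0.
Qed.

Lemma gmul_perm s t : gmul (gperm s) (gperm t) = gperm (t * s)%g.
Proof.
rewrite gmulE (bigD1 s) //= [X in _ + X]big1 ?addr0 => [|s' ss]; last first.
  by rewrite big1 // => t' _; rewrite ffunE (negPf ss) mul0r scale0r.
rewrite (bigD1 t) //= big1 ?addr0 => [|t' tt].
  by rewrite !ffunE !eqxx mulr1 scale1r.
by rewrite ffunE mulrC ffunE (negPf tt) mul0r scale0r.
Qed.

Lemma gmulDl : left_distributive gmul +%R.
Proof.
move=> a b c; apply/ffunP => u; rewrite !ffunE -big_split /=.
by apply: eq_bigr => p _; rewrite ffunE mulrDl.
Qed.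

Lemma gmulDr : right_distributive gmul +%R.
Proof.
move=> a b c; apply/ffunP => u; rewrite !ffunE -big_split /=.
by apply: eq_bigr => p _; rewrite ffunE mulrDr.
Qed.

Lemma gscaleAl (k : C) a b : k *: gmul a b = gmul (k *: a) b.
Proof.
apply/ffunP => u; rewrite !ffunE /GRing.scale /= mulr_sumr.
by apply: eq_bigr => p _; rewrite ffunE /GRing.scale /= mulrA.
Qed.

Lemma gscaleAr (k : C) a b : k *: gmul a b = gmul a (k *: b).
Proof.
apply/ffunP => u; rewrite !ffunE /GRing.scale /= mulr_sumr.
by apply: eq_bigr => p _; rewrite ffunE /GRing.scale /= mulrCA.
Qed.

Lemma gmul_suml I (r : seq I) (F : I -> grpalg) b :
  gmul (\sum_(i <- r) F i) b = \sum_(i <- r) gmul (F i) b.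
Proof.
have g0 : gmul 0 b = 0.
  by have := gscaleAl 0 0 b; rewrite !scale0r.
exact: (big_morph (gmul^~ b) (fun x y => gmulDl x y b) g0).
Qed.

Lemma gmul_sumr I (r : seq I) (F : I -> grpalg) a :
  gmul a (\sum_(i <- r) F i) = \sum_(i <- r) gmul a (F i).
Proof.
have g0 : gmul a 0 = 0.
  by have := gscaleAr 0 a 0; rewrite !scale0r.
exact: (big_morph (gmul a) (gmulDr a) g0).
Qed.

Lemma gmulA : associative gmul.
Proof.
move=> a b c; rewrite (gpermE a) !gmul_suml; apply: eq_bigr => s _.
rewrite (gpermE b) !gmul_suml !gmul_sumr gmul_suml; apply: eq_bigr => t _.
rewrite (gpermE c) !gmul_sumr; apply: eq_bigr => u _.
rewrite -!(gscaleAl, gscaleAr) !gmul_perm.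
by rewrite mulgA !scalerA mulrC mulrA.
Qed.

Lemma gmul1l : left_id (gperm 1%g) gmul.
Proof.
move=> a; rewrite (gpermE a) gmul_sumr; apply: eq_bigr => s _.
by rewrite -gscaleAr gmul_perm mulg1.
Qed.

Lemma gmul1r : right_id (gperm 1%g) gmul.
Proof.
move=> a; rewrite (gpermE a) gmul_suml; apply: eq_bigr => s _.
by rewrite -gscaleAl gmul_perm mul1g.
Qed.

Lemma gone_neq0 : gperm 1%g != 0.
Proof. by apply/eqP => /ffunP/(_ 1%g)/eqP; rewrite !ffunE eqxx oner_eq0. Qed.

HB.instance Definition _ := GRing.Zmodule_isNzRing.Build grpalg
  gmulA gmul1l gmul1r gmulDl gmulDr gone_neq0.
HB.instance Definition _ := GRing.Lmodule_isLalgebra.Build C grpalg gscaleAl.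
HB.instance Definition _ := GRing.Lalgebra_isAlgebra.Build C grpalg gscaleAr.

Definition gE (S : {set 'I_n}) : grpalg :=
  \sum_(s | perm_on S s) (-1) ^+ s *: gperm s.

Definition gH (S : {set 'I_n}) : grpalg := \sum_(s | perm_on S s) gperm s.

Definition block (nu : seq nat) (i : nat) : {set 'I_n} :=
  [set k : 'I_n | sumn (take i nu) <= k < sumn (take i.+1 nu)]%N.

(* The blocks with [i >= size nu] are empty and would contribute factors 1. *)
Definition gPi (W : set nat) (nu : seq nat) : grpalg :=
  (\prod_(i < size nu | (i : nat) \in W) gE (block nu i)) *
  (\prod_(i < size nu | (i : nat) \notin W) gH (block nu i)).

End GroupAlgebra.

Section Tensors.
Variables (C : numClosedFieldType) (l n : nat).

(* The n-th tensor power of [C^l]: [t f] is the coordinate of [t] along the basis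
   vector [e_(f 0) (x) ... (x) e_(f n.-1)]. *)
Definition tensor := {ffun {ffun 'I_n -> 'I_l} -> C^o}.

Definition pure_tensor (v : 'I_n -> 'cV[C]_l) : tensor :=
  [ffun f : {ffun 'I_n -> 'I_l} => \prod_k v k (f k) 0].

Definition tens_mx_fun (U : 'M[C]_l) (t : tensor) : tensor :=
  [ffun f : {ffun 'I_n -> 'I_l} =>
     \sum_(g : {ffun 'I_n -> 'I_l}) (\prod_k U (f k) (g k)) * t g].

Fact tens_mx_fun_linear U : linear (tens_mx_fun U).
Proof.
move=> a x y; apply/ffunP => f; rewrite !ffunE /GRing.scale /= mulr_sumr.
rewrite -big_split /=; apply: eq_bigr => g _.
by rewrite !ffunE /GRing.scale /= mulrDr mulrCA.
Qed.
HB.instance Definition _ U :=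
  GRing.isLinear.Build C tensor tensor _ (tens_mx_fun U) (tens_mx_fun_linear U).

Definition tens_mx (U : 'M[C]_l) : 'End(tensor) := linfun (tens_mx_fun U).

Lemma tens_mx_pure U v :
  tens_mx U (pure_tensor v) = pure_tensor (fun k => U *m v k).
Proof.
rewrite lfunE /=; apply/ffunP => f; rewrite !ffunE.
under [RHS]eq_bigr do rewrite mxE.
rewrite bigA_distr_bigA /=; apply: eq_bigr => g _.
by rewrite ffunE -big_split.
Qed.

Definition tens_perm_fun (s : 'S_n) (t : tensor) : tensor :=
  [ffun f : {ffun 'I_n -> 'I_l} => t [ffun k => f (s k)]].

Fact tens_perm_fun_linear s : linear (tens_perm_fun s).
Proof. by move=> a x y; apply/ffunP => f; rewrite !ffunE. Qed.
HB.instance Definition _ s :=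
  GRing.isLinear.Build C tensor tensor _ (tens_perm_fun s)
    (tens_perm_fun_linear s).

Definition tens_perm (s : 'S_n) : 'End(tensor) := linfun (tens_perm_fun s).

Lemma tens_perm_pure s v :
  tens_perm s (pure_tensor v) = pure_tensor (fun k => v ((s^-1)%g k)).
Proof.
rewrite lfunE /=; apply/ffunP => f; rewrite !ffunE.
rewrite [RHS](reindex_inj (@perm_inj _ s)) /=.
by apply: eq_bigr => k _; rewrite ffunE permK.
Qed.

Definition Tl (a : grpalg C n) : 'End(tensor) := \sum_s a s *: tens_perm s.

Lemma Tl_perm s : Tl (gperm C s) = tens_perm s.
Proof.
rewrite /Tl (bigD1 s) //= big1 => [|t ts]; first by rewrite ffunE eqxx scale1r addr0.
by rewrite ffunE (negPf ts) scale0r.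
Qed.

Fact Tl_linear : linear Tl.
Proof.
move=> k a b; rewrite /Tl scaler_sumr -big_split /=.
by apply: eq_bigr => s _; rewrite !ffunE scalerDl scalerA.
Qed.
HB.instance Definition _ :=
  GRing.isLinear.Build C (grpalg C n) 'End(tensor) _ Tl Tl_linear.

Lemma tens_perm_comp s t :
  (tens_perm s \o tens_perm t)%VF = tens_perm (t * s)%g.
Proof.
apply/lfunP => x; rewrite comp_lfunE !lfunE /=; apply/ffunP => f; rewrite !ffunE.
by congr (x _); apply/ffunP => k; rewrite !ffunE permM.
Qed.

Lemma Tl1 : Tl 1 = \1%VF.
Proof.
rewrite Tl_perm; apply/lfunP => x; rewrite !lfunE /=; apply/ffunP => f.
by rewrite ffunE; congr (x _); apply/ffunP => k; rewrite ffunE perm1.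
Qed.

Lemma comp_lfun_suml I (r : seq I) (F : I -> 'End(tensor)) (g : 'End(tensor)) :
  ((\sum_(i <- r) F i) \o g = \sum_(i <- r) (F i \o g))%VF.
Proof.
exact: (big_morph (fun f => (f \o g)%VF) (fun f h => comp_lfunDl f h g)
         (comp_lfun0l _ g)).
Qed.

Lemma comp_lfun_sumr I (r : seq I) (F : I -> 'End(tensor)) (g : 'End(tensor)) :
  (g \o (\sum_(i <- r) F i) = \sum_(i <- r) (g \o F i))%VF.
Proof.
exact: (big_morph (fun f => (g \o f)%VF) (comp_lfunDr g) (comp_lfun0r _ g)).
Qed.

Lemma TlM a b : Tl (a * b) = (Tl a \o Tl b)%VF.
Proof.
have -> : a * b = \sum_s \sum_t (a s * b t) *: gperm C (t * s)%g := gmulE a b.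
rewrite linear_sum comp_lfun_suml; apply: eq_bigr => s _.
rewrite linear_sum comp_lfun_sumr; apply: eq_bigr => t _.
rewrite linearZ /= Tl_perm -comp_lfunZl -comp_lfunZr scalerA.
by rewrite tens_perm_comp.
Qed.

Definition CnU (A : 'End(tensor)) : Prop :=
  forall U : 'M[C]_l, U \is unitarymx ->
    (A \o tens_mx U)%VF = (tens_mx U \o A)%VF.

Lemma Tl_CnU a : CnU (Tl a).
Proof.
move=> U _; rewrite comp_lfun_suml comp_lfun_sumr; apply: eq_bigr => s _.
rewrite -comp_lfunZl -comp_lfunZr; congr (_ *: _).
apply/lfunP => x; rewrite !comp_lfunE !lfunE /=; apply/ffunP => f; rewrite !ffunE.
rewrite (reindex_inj (h := fun g : {ffun 'I_n -> 'I_l} => [ffun k => g (s k)])) /=.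
  apply: eq_bigr => g _; rewrite ffunE; congr (_ * _).
  rewrite [RHS](reindex_inj (@perm_inj _ s)) /=.
  by apply: eq_bigr => k _; rewrite !ffunE.
move=> g h /ffunP gh; apply/ffunP => k.
by have := gh ((s^-1)%g k); rewrite !ffunE permKV.
Qed.

Definition PiCnUPi (W W' : set nat) (nu nu' : seq nat) (B : 'End(tensor)) : Prop :=
  exists2 A, CnU A & B = (Tl (gPi C n W' nu') \o A \o Tl (gPi C n W nu))%VF.

Definition Tl_mset (W W' : set nat) (nu nu' : seq nat) (s : 'S_n) : 'End(tensor) :=
  Tl (gPi C n W' nu' * gperm C s * gPi C n W nu).

End Tensors.

Local Open Scope mset_scope.

Section Multisets.
Variables (W W' : set nat).
Implicit Types (M : {mset nat * nat}) (p q : nat * nat) (s : seq (nat * nat)).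

Definition compatible M : Prop :=
  forall i j, (i \in W) (+) (j \in W') -> (M (i, j) <= 1)%N.

Definition msetsU (nu nu' : seq nat) M : Prop :=
  [/\ compatible M,
      forall i, count (fun p => p.1 == i) (enum_mset M) = nth 0 nu i
    & forall j, count (fun p => p.2 == j) (enum_mset M) = nth 0 nu' j]%N.

Definition decr p q : bool :=
  [&& p.1 <= q.1, q.2 <= p.2, (p.1 == q.1) ==> (p.1 \in W)
    & (p.2 == q.2) ==> (p.2 \in W')]%N.

Definition decr_seq_of M s : bool := sorted decr s && (seq_mset s `<=` M).

(* The bound [k <= #|M|] only serves to make the maximum finite: it holds for
   every sequence of elements of [M]. *)
Definition ellminus M : nat :=
  \max_(k < (size (enum_mset M)).+1 |
          `[< exists2 s, decr_seq_of M s & size s = k >]) k.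

Lemma leq_ellminus M s : decr_seq_of M s -> (size s <= ellminus M)%N.
Proof.
move=> ds; have sM : (size s < (size (enum_mset M)).+1)%N.
  have /andP[_ /msubsetP sM] : decr_seq_of M s := ds.
  have /count_subseqP[s' /size_subseq ? /perm_size ->] :
      forall p, (count_mem p s <= count_mem p (enum_mset M))%N.
    by move=> p; rewrite count_mem_mset -mset_seqE.
  by rewrite ltnS.
by apply: (leq_bigmax_cond (Ordinal sM)); apply/asboolP; exists s.
Qed.

End Multisets.

(* [M] is the multiset of the pairs [(i, j)] of indices of the blocks containing
   [k] and [s k], for [k] in ['I_n]. *)
Definition represents n (nu nu' : seq nat) (s : 'S_n) (M : {mset nat * nat}) : Prop :=
  forall i j, M (i, j) = #|[set k in block n nu i | s k \in block n nu' j]|.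

(* The family [f] indexed by [P] is a basis of the set [S] of vectors: it is
   linearly independent as an indexed family, and its span is [S]. *)
Definition is_basis (K : fieldType) (V : vectType K) (I : eqType)
    (P : I -> Prop) (f : I -> V) (S : V -> Prop) : Prop :=
  (forall s : seq I, uniq s -> (forall i, i \in s -> P i) -> free (map f s)) /\
  (forall v, S v <->
     exists2 s : seq I, (forall i, i \in s -> P i) & v \in <<map f s>>%VS).

(* Main.v *)
Require Import Defs.
From HB Require Import structures.
From mathcomp Require Import all_boot all_order all_algebra all_fingroup.
From mathcomp Require Import finmap multiset complex.
From mathcomp Require Import boolp classical_sets reals.
From mathcomp Require Import zify ring.
Local Open Scope ring_scope.
Local Open Scope mset_scope.

Set Implicit Arguments.
Unset Strict Implicit.
Unset Printing Implicit Defensive.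

Import Order.TTheory GRing.Theory Num.Theory.

(* Write [weight s] for the sum over [k] of (block of [k]) * (block of [s k]).

   Spanning. By Schur-Weyl duality the space is spanned by the images of the
   [Pi(nu') s Pi(nu)]. If the multiset of [s] has a decreasing sequence of length
   greater than [l], occupying the set of positions [S], then [s E_S], summed over
   the permutations of [S], vanishes on the tensor power. By the rearrangement
   inequality every term has weight at least that of [s], and in the case of
   equality the term is [Pi(nu') s Pi(nu)] itself, with sign [+]; so induction on
   the weight applies.

   Independence. If all decreasing sequences have length at most [l], then the
   positions can be coloured by [l] colours (Mirsky) so that each colour class is
   increasing. Viewing the colouring [f] as a basis tensor, the entry of [T_l(M')]
   at the pair of [f] and its transport by the permutation of [M] is nonzero for
   [M' = M], and is nonzero for another [M'] only if the weight of [M'] is smaller: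
   an increasing pairing maximizes the weight. *)

(** * Fibres, chains and layer counts *)

Section Counting.
Variable n : nat.

Lemma count_mem_codom (X : eqType) (F : 'I_n -> X) v :
  count_mem v [seq F k | k <- enum 'I_n] = #|[set k | F k == v]|.
Proof.
rewrite count_map -sum1_count big_enum_cond /= -sum1_card.
by apply: eq_bigl => k; rewrite !inE.
Qed.

(** Equal fibre sizes make the value lists of [F] and [G] rearrangements of each other. *)
Lemma exists_perm_fibers (X : eqType) (F G : 'I_n -> X) :
  (forall v, #|[set k | F k == v]| = #|[set k | G k == v]|) ->
  exists a : 'S_n, forall k, F (a k) = G k.
Proof.
move=> FG; have /tuple_permP[a Ga] :
    perm_eq [seq G k | k <- enum 'I_n] [tuple F k | k < n].
  by apply/allP => v _ /=; rewrite !count_mem_codom FG.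
exists a => k; have := congr1 (fun s => nth (F k) s k) Ga.
rewrite (nth_map k) ?size_enum_ord // nth_ord_enum => ->.
by rewrite -tnth_nth !tnth_mktuple.
Qed.

(** The positions with value at least [i] split into those with value [i] and those with larger
    value, so consecutive threshold counts determine the fibres. *)
Lemma card_fiber_of_ge (P Q : pred 'I_n) (x y : 'I_n -> nat) :
  (forall i, #|[set k | P k && (i <= x k)%N]| =
             #|[set k | Q k && (i <= y k)%N]|) ->
  forall i, #|[set k | P k && (x k == i)]| = #|[set k | Q k && (y k == i)]|.
Proof.
move=> PQ i.
have split_ge (P' : pred 'I_n) (z : 'I_n -> nat) :
    (#|[set k | P' k && (i <= z k)%N]| =
      #|[set k | P' k && (z k == i)]| + #|[set k | P' k && (i < z k)%N]|)%N.
  rewrite -(cardsID [set k | z k == i]); congr (_ + _)%N; apply: eq_card => k.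
    by rewrite !inE -andbA; case: (P' k) => //=; case: eqP => [->|]; rewrite ?leqnn ?andbF.
  by rewrite !inE andbCA; congr andb; rewrite ltn_neqAle eq_sym.
by have := PQ i; rewrite !split_ge (PQ i.+1) => /addIn.
Qed.

Lemma perm_eq_map_lift (T X : eqType) (F : T -> X) (t : seq X) (r : seq T) :
  perm_eq t (map F r) -> exists2 r', perm_eq r' r & map F r' = t.
Proof.
elim: t r => [|v t IH] r tr.
  have /eqP : size (map F r) = 0 by rewrite -(perm_size tr).
  by rewrite size_map size_eq0 => /eqP ->; exists [::].
have /mapP[k kr vE] : v \in map F r by rewrite -(perm_mem tr) mem_head.
have := perm_trans tr (perm_map F (perm_to_rem kr)).
rewrite vE /= perm_cons => /IH[r' r'r <-]; exists (k :: r') => //.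
by rewrite perm_sym (perm_trans (perm_to_rem kr)) // perm_cons perm_sym.
Qed.

(** Turns a sequence of values, each used within its multiplicity, into distinct positions: this is
    how a chain of a multiset becomes a set of positions. *)
Lemma uniq_lift_seq (X : eqType) (F : 'I_n -> X) (t : seq X) :
  (forall v, count_mem v t <= #|[set k | F k == v]|)%N ->
  exists2 r : seq 'I_n, uniq r & map F r = t.
Proof.
move=> tF; have /count_subseqP[t' t'F tt'] :
    forall v, (count_mem v t <= count_mem v [seq F k | k <- enum 'I_n])%N.
  by move=> v; rewrite count_mem_codom.
have [m _ t'E] := subseqP t'F.
move: tt'; rewrite t'E -map_mask => /perm_eq_map_lift[r rE rt].
by exists r => //; rewrite (perm_uniq rE) mask_uniq // enum_uniq.
Qed.

Lemma card_lift_seq (X : eqType) (F : 'I_n -> X) (r : seq 'I_n) v :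
  uniq r -> (count_mem v (map F r) <= #|[set k | F k == v]|)%N.
Proof.
move=> r_uniq; rewrite count_map -size_filter cardE.
apply: uniq_leq_size; first exact: filter_uniq.
by move=> k; rewrite mem_filter mem_enum [_ \in finset _]inE => /andP[].
Qed.

(* Mirsky: peel off the minimal elements. *)
Lemma antichain_coloring (r : rel 'I_n) (l : nat) :
  (forall t, sorted r t -> (size t <= l)%N) ->
  exists2 f : 'I_n -> nat, forall k, (f k < l)%N &
    forall k k', r k k' -> (f k < f k')%N.
Proof.
move=> chainr.
suff [f fl fr] : exists2 f : 'I_n -> nat,
    {in [set: 'I_n], forall k, (f k < l)%N} &
    {in [set: 'I_n] &, forall k k', r k k' -> (f k < f k')%N}.
  exists f => [k|k k']; first by apply: fl; rewrite inE.
  by apply: fr; rewrite inE.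
have: forall t, {subset t <= [set: 'I_n]} -> sorted r t -> (size t <= l)%N.
  by move=> t _; apply: chainr.
elim: l [set: 'I_n] {chainr} => [|l IH] D chainD.
  have D0 k : k \in D -> False.
    move=> Dk; suff: (size [:: k] <= 0)%N by [].
    by apply: chainD => // j; rewrite inE => /eqP ->.
  by exists (fun=> 0) => [k|k k'] /D0.
pose D' := [set k in D | [exists k' in D, r k' k]].
have [|f fl fr] := IH D'.
  case=> [|k t] // tD' ts.
  have: k \in D' by rewrite tD' ?mem_head.
  rewrite inE => /andP[Dk /existsP[k' /andP[Dk' rk'k]]].
  suff : (size (k' :: k :: t) <= l.+1)%N by [].
  apply: chainD => [j|]; last by rewrite /= rk'k.
  rewrite inE => /orP[/eqP -> //|/tD'].
  by rewrite inE => /andP[].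
exists (fun k => if k \in D' then (f k).+1 else 0) => [k Dk|k k' Dk Dk' rkk'].
  by case: ifP => // /fl.
have D'k' : k' \in D'.
  by rewrite inE Dk'; apply/existsP; exists k; rewrite Dk.
by rewrite D'k'; case: ifP => // D'k; rewrite ltnS fr.
Qed.

(** Layer-cake formula: each product counts the threshold pairs [(i, j)] with [i <= x k] and
    [j <= y k], the successors accounting for the threshold 0. Recording the colour allows a
    comparison inside each colour class. *)
Lemma sum_layers (B : nat) (x y : 'I_n -> nat) (K : finType) (c : 'I_n -> K) :
  (forall k, x k < B)%N -> (forall k, y k < B)%N ->
  (\sum_k (x k).+1 * (y k).+1 =
   \sum_(t : K * 'I_B * 'I_B)
     #|[set k | [&& c k == t.1.1, t.1.2 <= x k & t.2 <= y k]]|)%N.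
Proof.
move=> xB yB.
have layer m : (m < B)%N -> (m.+1 = \sum_(i < B) (i <= m))%N.
  move=> mB; rewrite -(big_mkord xpredT (fun i => (i <= m)%N : nat)).
  rewrite (big_cat_nat (n := m.+1)) //=.
  have -> : (\sum_(m.+1 <= i < B) (i <= m) = 0)%N.
    rewrite big_nat_cond big1 // => i.
    by rewrite andbT ltnNge => /andP[/negPf ->].
  rewrite addn0 big_nat_cond (eq_bigr (fun=> 1)) => [|i /andP[/andP[_]]].
    by rewrite -big_nat_cond sum_nat_const_nat muln1 subn0.
  by rewrite ltnS => ->.
transitivity (\sum_(t : K * 'I_B * 'I_B) \sum_k
    ([&& c k == t.1.1, t.1.2 <= x k & t.2 <= y k] : nat))%N; last first.
  apply: eq_bigr => t _; rewrite -sum1_card [RHS]big_mkcond /=.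
  by apply: eq_bigr => k _; rewrite inE; case: [&& _, _ & _].
rewrite exchange_big /=; apply: eq_bigr => k _.
rewrite -(pair_big xpredT xpredT (fun (p : K * 'I_B) (j : 'I_B) =>
   ([&& c k == p.1, p.2 <= x k & j <= y k]%N : nat))) /=.
rewrite -(pair_big xpredT xpredT (fun (p : K) (i : 'I_B) =>
   \sum_(j < B) ([&& c k == p, i <= x k & j <= y k] : nat))%N) /=.
rewrite (bigD1 (c k)) //= [X in (_ + X)%N]big1 ?addn0 => [|d /negPf dk]; last first.
  by rewrite big1 // => i _; rewrite big1 // => j _; rewrite eq_sym dk.
rewrite (layer (x k)) // (layer (y k)) // big_distrl /=.
apply: eq_bigr => i _; rewrite big_distrr /=; apply: eq_bigr => j _.
by rewrite eqxx mulnb.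
Qed.

(** * The rearrangement inequality within colour classes *)

Section Rearrangement.
Variables (K : finType) (c : 'I_n -> K) (x y : 'I_n -> nat) (s : 'S_n).
Hypothesis cosorted :
  forall k k', c k = c k' -> (x k < x k' -> y k <= y k')%N.
Hypothesis color_s : forall k, c (s k) = c k.

(** Inside a colour class the upper level sets [X] of [x] and [Y] of [y] are nested, so [X :&: Y]
    has the size of the smaller one, which bounds the intersection of [X] with any set of the size
    of [Y]. *)
Lemma leq_card_layer d i j :
  (#|[set k | [&& c k == d, i <= x k & j <= y (s k)]]| <=
   #|[set k | [&& c k == d, i <= x k & j <= y k]]|)%N.
Proof.
pose X := [set k | (c k == d) && (i <= x k)%N].
pose Y := [set k | (c k == d) && (j <= y k)%N].
have cardY : #|s @^-1: Y| = #|Y|.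
  rewrite on_card_preimset //; apply: onW_bij; exists (s^-1)%g => k.
    by rewrite permK.
  by rewrite permKV.
have -> : [set k | [&& c k == d, i <= x k & j <= y (s k)]]%N = X :&: s @^-1: Y.
  by apply/setP => k; rewrite !inE color_s; case: (c k == d).
have -> : [set k | [&& c k == d, i <= x k & j <= y k]]%N = X :&: Y.
  by apply/setP => k; rewrite !inE; case: (c k == d).
have [/finset.setIidPl -> |/subsetPn[a Xa Ya]] := boolP (X \subset Y).
  by rewrite subset_leq_card // finset.subsetIl.
have [/finset.setIidPr -> |/subsetPn[b Yb Xb]] := boolP (Y \subset X).
  by rewrite -cardY subset_leq_card // finset.subsetIr.
(* If neither set contained the other, the witnesses [a] and [b] would contradict [cosorted]. *)
move: Xa Ya Yb Xb; rewrite !inE.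
case/andP=> /[dup] ca -> ia; rewrite -ltnNge /= => ja.
case/andP=> /[dup] cb -> jb; rewrite -ltnNge /= => ib.
have := cosorted (k := b) (k' := a); rewrite (eqP ca) (eqP cb) => /(_ erefl).
by rewrite (leq_trans ib ia) => /(_ isT) /(leq_trans jb); rewrite leqNgt ja.
Qed.

(** The correction terms do not change when [z] is permuted, so the shifted sums compare as the
    original ones do. *)
Lemma sum_succ_mul (z : 'I_n -> nat) :
  (\sum_k (x k).+1 * (z k).+1 =
   \sum_k x k * z k + (\sum_k x k + \sum_k z k + \sum_(k < n) 1))%N.
Proof.
rewrite -!big_split /=; apply: eq_bigr => k _.
by lia.
Qed.

Lemma rearrangement : (\sum_k x k * y (s k) <= \sum_k x k * y k)%N.
Proof.
pose B := (\max_k x k + \max_k y k).+1.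
have xB k : (x k < B)%N by rewrite ltnS (leq_trans _ (leq_addr _ _)) // leq_bigmax.
have yB k : (y k < B)%N by rewrite ltnS (leq_trans _ (leq_addl _ _)) // leq_bigmax.
have sum_ys : (\sum_k y (s k) = \sum_k y k)%N.
  by rewrite [RHS](reindex_inj (@perm_inj _ s)).
rewrite -(leq_add2r (\sum_k x k + \sum_k y k + \sum_(k < n) 1)) -{1}sum_ys -!sum_succ_mul.
rewrite !(sum_layers (B := B) c) //.
by apply: leq_sum => t _; apply: leq_card_layer.
Qed.

(** Equality of the sums forces equality in every layer, and the layer sizes determine how often
    each triple of colour, [x]-value and [y]-value occurs. *)
Lemma rearrangement_eq : (\sum_k x k * y (s k) = \sum_k x k * y k)%N ->
  exists a : 'S_n, forall k, [/\ c (a k) = c k, x (a k) = x k & y (s (a k)) = y k].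
Proof.
move=> eq_sum.
pose B := (\max_k x k + \max_k y k).+1.
have xB k : (x k < B)%N by rewrite ltnS (leq_trans _ (leq_addr _ _)) // leq_bigmax.
have yB k : (y k < B)%N by rewrite ltnS (leq_trans _ (leq_addl _ _)) // leq_bigmax.
have sum_ys : (\sum_k y (s k) = \sum_k y k)%N.
  by rewrite [RHS](reindex_inj (@perm_inj _ s)).
have layer_eq d i j :
    #|[set k | [&& c k == d, i <= x k & j <= y (s k)]]|%N =
    #|[set k | [&& c k == d, i <= x k & j <= y k]]|%N.
  have [iB|Bi] := ltnP i B; last first.
    by apply: eq_card => k; rewrite !inE !(leqNgt i) (leq_trans (xB k) Bi) !andbF.
  have [jB|Bj] := ltnP j B; last first.
    apply: eq_card => k; rewrite !inE !(leqNgt j) (leq_trans (yB k) Bj).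
    by rewrite (leq_trans (yB (s k)) Bj) !andbF.
  (* The inequality holds layer by layer, so equal totals leave no strict layer. *)
  have := @leqif_sum _ xpredT _ _ _ (fun (t : K * 'I_B * 'I_B) _ =>
    leqif_geq (leq_card_layer t.1.1 t.1.2 t.2)).
  case=> _; rewrite -!sum_layers //.
  rewrite !sum_succ_mul eq_sum sum_ys eqxx => /esym/forallP/(_ (d, Ordinal iB, Ordinal jB)).
  by move=> /= ge; apply/eqP; rewrite eqn_leq leq_card_layer.
have [[[d i] j]|a aP] := @exists_perm_fibers _
    (fun k => (c k, x k, y (s k))) (fun k => (c k, x k, y k)).
  transitivity #|[set k | (c k == d) && (x k == i) && (y (s k) == j)]|.
    by apply: eq_card => k; rewrite !inE.
  transitivity #|[set k | (c k == d) && (x k == i) && (y k == j)]|; last first.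
    by apply: eq_card => k; rewrite !inE.
  (* Thresholds are converted to exact values one coordinate at a time. *)
  apply: (@card_fiber_of_ge (fun k => (c k == d) && (x k == i))
    (fun k => (c k == d) && (x k == i)) (fun k => y (s k)) y) => j'.
  transitivity #|[set k | (c k == d) && (j' <= y (s k))%N && (x k == i)]|.
    by apply: eq_card => k; rewrite !inE andbAC.
  transitivity #|[set k | (c k == d) && (j' <= y k)%N && (x k == i)]|; last first.
    by apply: eq_card => k; rewrite !inE andbAC.
  apply: (@card_fiber_of_ge (fun k => (c k == d) && (j' <= y (s k))%N)
    (fun k => (c k == d) && (j' <= y k)%N) x x) => i'.
  transitivity #|[set k | [&& c k == d, i' <= x k & j' <= y (s k)]]|%N.
    by apply: eq_card => k; rewrite !inE andbAC andbA.
  rewrite layer_eq; apply: eq_card => k.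
  by rewrite !inE andbAC andbA.
by exists a => k; have [-> -> ->] := aP k.
Qed.

End Rearrangement.
End Counting.

(** * Schur-Weyl duality *)

Lemma poly_nat_nonroot (C : numDomainType) (p : {poly C}) :
  p != 0 -> exists m : nat, p.[m%:R] != 0.
Proof.
move=> p0; apply: contrapT => nop.
have : (size [seq m%:R : C | m <- iota 0 (size p)] < size p)%N.
  apply: max_poly_roots => //; last first.
    by rewrite map_inj_uniq ?iota_uniq // => i j /eqP; rewrite eqr_nat => /eqP.
  apply/allP => x /mapP[m _ ->]; rewrite rootE.
  by apply: contrapT => /negP pm; apply: nop; exists m.
by rewrite size_map size_iota ltnn.
Qed.

(** For a bijective [phi] only the full set contributes. Otherwise toggling a point [j] outside the
    image of [phi] is a sign-reversing involution on the subsets. *)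
Lemma signed_subset_sum (C : numFieldType) n (phi : {ffun 'I_n -> 'I_n}) :
  \sum_(S : {set 'I_n}) (-1) ^+ #|S| * [forall k, phi k \in S]%:R =
  (-1) ^+ n * (injectiveb phi)%:R :> C.
Proof.
have [phi_inj|/negP phi_ninj] := boolP (injectiveb phi).
  rewrite (bigD1 [set: 'I_n]) //= big1 ?addr0 => [|S].
    by rewrite cardsT card_ord; case: forallP => // -[] k; rewrite inE.
  have [] := boolP [forall k, phi k \in S]; last by rewrite mulr0.
  move=> /forallP phiS /eqP[]; apply/setP => k; rewrite inE.
  by have /codomP[k' ->] := injF_onto (injectiveP _ phi_inj) k; rewrite phiS.
have [j jphi] : exists j, j \notin codom phi.
  apply: contrapT => all_codom; apply: phi_ninj; apply/injectiveP => x y.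
  apply: (image_injP (A := 'I_n) _) => //.
  apply/eqP/eq_card => j; rewrite [RHS]inE; apply: contrapT => /negP jphi.
  by apply: all_codom; exists j.
pose flip (S : {set 'I_n}) := if j \in S then S :\ j else j |: S.
have flipK : involutive flip.
  move=> S; rewrite /flip; have [Sj|Sj] := boolP (j \in S).
    by rewrite finset.setD11 finset.setD1K.
  by rewrite finset.setU11 finset.setU1K.
have flip_sign S : (-1) ^+ #|flip S| = - (-1) ^+ #|S| :> C.
  rewrite /flip; have [Sj|Sj] := boolP (j \in S).
    by rewrite [in RHS](cardsD1 j) Sj exprS mulN1r opprK.
  by rewrite cardsU1 Sj exprS mulN1r.
have flip_phi S : [forall k, phi k \in flip S] = [forall k, phi k \in S].
  apply: eq_forallb => k.
  have /negPf jk : phi k != j by apply: contraNneq jphi => <-; apply: codom_f.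
  by rewrite /flip; case: ifP; rewrite !inE jk.
rewrite mulr0; set x := (X in X = 0); have : x = - x.
  rewrite {1}/x (reindex_inj (inv_inj flipK)) -sumrN; apply: eq_bigr => S _.
  by rewrite flip_phi flip_sign mulNr.
by move/eqP; rewrite -addr_eq0 -mulr2n -mulr_natr mulf_eq0 pnatr_eq0 orbF => /eqP.
Qed.

(** Ryser's formula for the permanent: after expansion over all maps [phi], inclusion-exclusion
    keeps the injective ones. *)
Lemma perm_sum_prod (C : numFieldType) n (y : 'I_n -> 'I_n -> C) :
  \sum_(S : {set 'I_n}) (-1) ^+ #|S| * \prod_k \sum_(j in S) y j k =
  (-1) ^+ n * \sum_(s : 'S_n) \prod_k y (s k) k.
Proof.
under eq_bigr => S _.
  under eq_bigr => k _ do rewrite big_mkcond.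
  rewrite bigA_distr_bigA /= mulr_sumr.
  under eq_bigr => phi _.
    have -> : \prod_k (if phi k \in S then y (phi k) k else 0) =
       [forall k, phi k \in S]%:R * \prod_k y (phi k) k.
      have [/forallP phiS|] := boolP [forall k, phi k \in S].
        by rewrite mul1r; apply: eq_bigr => k _; rewrite phiS.
      rewrite negb_forall => /existsP[k /negPf phik].
      by rewrite (bigD1 k) //= phik !mul0r.
    rewrite mulrA.
  over.
over.
rewrite exchange_big /=.
under eq_bigr => phi _ do rewrite -mulr_suml signed_subset_sum -mulrA.
rewrite -mulr_sumr; congr (_ * _).
rewrite (bigID (fun phi : {ffun 'I_n -> 'I_n} => injectiveb phi)) /= addrC.
rewrite big1 ?add0r => [|phi /negPf ->]; last by rewrite mul0r.
rewrite (reindex (fun s : 'S_n => val s)) /=.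
  apply: eq_big => s; first by rewrite (valP s).
  by move=> inj; rewrite inj mul1r; apply: eq_bigr => k _; rewrite pvalE.
exists (insubd (1%g : 'S_n)) => /= phi inj; first by apply: val_inj; apply: insubdK.
exact: insubdK.
Qed.

Section SchurWeyl.
Variables (C : numClosedFieldType) (l n : nat).
Notation idx := {ffun 'I_n -> 'I_l}.
Notation tensor := (tensor C l n).

Definition ebase (f : idx) : tensor := [ffun h => (h == f)%:R].

Lemma tensor_sum_ebase (t : tensor) : t = \sum_f t f *: ebase f.
Proof.
apply/ffunP => h; rewrite sum_ffunE (bigD1 h) //= big1 ?addr0 => [|f fh].
  by rewrite !ffunE eqxx /GRing.scale /= mulr1.
by rewrite !ffunE eq_sym (negPf fh) /GRing.scale /= mulr0.
Qed.

Lemma lfun_ebase_eq (A B : 'End(tensor)) :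
  (forall f, A (ebase f) = B (ebase f)) -> A = B.
Proof.
move=> AB; apply/lfunP => t; rewrite (tensor_sum_ebase t) !linear_sum.
by apply: eq_bigr => f _; rewrite !linearZ /= AB.
Qed.

Lemma tens_mx_ebase (X : 'M[C]_l) (g h : idx) :
  tens_mx n X (ebase g) h = \prod_k X (h k) (g k).
Proof.
rewrite lfunE /= ffunE (bigD1 g) //= [X in _ + X]big1 ?addr0 => [|f fg].
  by rewrite ffunE eqxx mulr1.
by rewrite ffunE (negPf fg) mulr0.
Qed.

Definition tcomm (A : 'End(tensor)) (X : 'M[C]_l) : Prop :=
  (A \o tens_mx n X = tens_mx n X \o A)%VF.

Lemma tcommP A X : tcomm A X <->
  forall f g : idx,
    \sum_(h : idx) A (ebase h) f * (\prod_k X (h k) (g k)) =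
    \sum_(h : idx) (\prod_k X (f k) (h k)) * A (ebase g) h.
Proof.
have lhsE (f g : idx) : (A \o tens_mx n X)%VF (ebase g) f =
    \sum_(h : idx) A (ebase h) f * (\prod_k X (h k) (g k)).
  rewrite comp_lfunE (tensor_sum_ebase (tens_mx n X _)) linear_sum sum_ffunE.
  by apply: eq_bigr => h _; rewrite linearZ /= ffunE tens_mx_ebase /GRing.scale /= mulrC.
have rhsE (f g : idx) : (tens_mx n X \o A)%VF (ebase g) f =
    \sum_(h : idx) (\prod_k X (f k) (h k)) * A (ebase g) h.
  by rewrite comp_lfunE /tens_mx lfunE /= ffunE.
split=> [AX f g|AX]; first by rewrite -lhsE AX rhsE.
by apply: lfun_ebase_eq => g; apply/ffunP => f; rewrite lhsE rhsE AX.
Qed.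

Lemma tens_mxZ a (X : 'M[C]_l) : tens_mx n (a *: X) = a ^+ n *: tens_mx n X.
Proof.
apply: lfun_ebase_eq => g; apply/ffunP => h.
rewrite scale_lfunE ffunE !tens_mx_ebase /GRing.scale /=.
under eq_bigr do rewrite mxE.
by rewrite big_split /= prodr_const card_ord.
Qed.

Lemma tcommZ A a X : a != 0 -> tcomm A (a *: X) -> tcomm A X.
Proof.
move=> a0; rewrite /tcomm tens_mxZ -comp_lfunZl -comp_lfunZr.
by apply: scalerI; rewrite expf_eq0 (negPf a0) andbF.
Qed.

(** Each entry of the commutator is a polynomial in the parameter with all natural numbers as
    roots. *)
Lemma tcomm_poly A (P : 'M[{poly C}]_l) :
  (forall m : nat, tcomm A (map_mx (horner_eval m%:R) P)) ->
  forall t, tcomm A (map_mx (horner_eval t) P).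
Proof.
move=> AP t; apply/tcommP => f g.
pose p := \sum_(h : idx) (A (ebase h) f)%:P * (\prod_k P (h k) (g k)) -
    \sum_(h : idx) (\prod_k P (f k) (h k)) * (A (ebase g) h)%:P.
have pE x : p.[x] =
    \sum_(h : idx) A (ebase h) f * (\prod_k map_mx (horner_eval x) P (h k) (g k)) -
    \sum_(h : idx) (\prod_k map_mx (horner_eval x) P (f k) (h k)) * A (ebase g) h.
  rewrite /p hornerD hornerN !horner_sum; congr (_ - _); apply: eq_bigr => h _.
    by rewrite hornerM hornerC horner_prod; under [in RHS]eq_bigr do rewrite mxE.
  by rewrite hornerM hornerC horner_prod; under [in RHS]eq_bigr do rewrite mxE.
have p0 : p = 0.
  apply: contrapT => /eqP /poly_nat_nonroot[m] /eqP[].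
  rewrite pE; apply/eqP; rewrite subr_eq0; apply/eqP.
  by have /tcommP -> := AP m.
by apply/eqP; rewrite -subr_eq0 -pE p0 horner0.
Qed.

(** If [v (1 + K) = 0], then [v v^* = - v K v^*]; the left side is Hermitian and the right side
    skew-Hermitian, so the squared norm of [v] vanishes. *)
Lemma skew_unit (K : 'M[C]_l) : (K ^t*)%sesqui = - K -> 1%:M + K \in unitmx.
Proof.
move=> Kskew; rewrite -row_free_unit -kermx_eq0; apply/rowV0P => v.
move/sub_kermxP; rewrite mulmxDr mulmx1 => /eqP.
rewrite addr_eq0 => /eqP vE.
have vvE : v *m (v ^t*)%sesqui = - (v *m K *m (v ^t*)%sesqui).
  by rewrite {1}vE mulNmx.
have : v *m (v ^t*)%sesqui = - (v *m (v ^t*)%sesqui).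
  have NN : ((v *m (v ^t*) ) ^t*)%sesqui = v *m (v ^t*)%sesqui.
    by rewrite trmx_mul map_mxM trmxCK.
  have KK : ((v *m K *m (v ^t*)) ^t*)%sesqui = - (v *m K *m (v ^t*)%sesqui).
    by rewrite !trmx_mul !map_mxM trmxCK Kskew mulNmx mulmxN mulmxA.
  by rewrite -{1}NN vvE linearN /= map_mxN KK.
move/eqP; rewrite -addr_eq0 -mulr2n -scaler_nat scaler_eq0 pnatr_eq0 /= => /eqP.
move/matrixP/(_ 0 0); rewrite !mxE => /psumr_eq0P v0; apply/rowP => i.
have := v0 _ i isT; rewrite !mxE => /(_ _)/eqP.
by rewrite mul_conjC_eq0 => v_i; apply/eqP/v_i => j _; rewrite !mxE mul_conjC_ge0.
Qed.

(** The adjoint exchanges [1 + K] and [1 - K], and these two matrices commute. *)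
Lemma cayley_unitary (K : 'M[C]_l) : (K ^t*)%sesqui = - K ->
  (1%:M - K) *m invmx (1%:M + K) \is unitarymx.
Proof.
move=> Kskew; have uP := skew_unit Kskew.
have uN : 1%:M - K \in unitmx by apply: skew_unit; rewrite linearN /= map_mxN Kskew.
apply/unitarymxP; rewrite trmx_mul map_mxM trmx_inv map_invmx.
have -> : ((1%:M + K) ^t*)%sesqui = 1%:M - K.
  by rewrite linearD /= map_mxD trmx1 map_mx1 Kskew.
have -> : ((1%:M - K) ^t*)%sesqui = 1%:M + K.
  by rewrite linearB /= map_mxB trmx1 map_mx1 Kskew opprK.
have comm : (1%:M - K) *m invmx (1%:M + K) = invmx (1%:M + K) *m (1%:M - K).
  apply: (canRL (mulKmx uP)); rewrite mulmxA.
  have -> : (1%:M + K) *m (1%:M - K) = (1%:M - K) *m (1%:M + K).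
    by rewrite mulmxDl mulmxBl !mul1mx mulmxBr mulmxDr mulmx1 addrA subrK opprD addrA addrK.
  by rewrite mulmxK.
by rewrite comm !mulmxA -(mulmxA (invmx _)) mulmxV // mulmx1 mulVmx.
Qed.

(* The unitary group is Zariski dense: writing [K = K1 + 'i K2] with [K1] and [K2]
   skew-Hermitian, the Cayley transform of [K1 + m K2] is unitary for every natural
   number [m], so that a polynomial identity in [m] extends to [m = 'i]. *)
Lemma tcomm_all A : CnU A -> forall X, tcomm A X.
Proof.
move=> AU.
(* The adjugate stands for the inverse, which keeps the entries polynomial; the two differ by a
   nonzero determinant, removed by [tcommZ]. *)
have tcomm_adj K : tcomm A ((1%:M - K) *m \adj (1%:M + K)).
  pose K1 := 2^-1 *: (K - (K ^t*)%sesqui).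
  pose K2 := (2 * 'i)^-1 *: (K + (K ^t*)%sesqui).
  have i0 : 'i != 0 :> C by rewrite -normr_eq0 normCi oner_eq0.
  have Kc : K1 + 'i *: K2 = K.
    by apply/matrixP => i j; rewrite !mxE; field; rewrite i0.
  have K1s : (K1 ^t*)%sesqui = - K1.
    by apply/matrixP => i j; rewrite !mxE rmorphM rmorphB fmorphV /= conjCK
        conjC_nat -mulrN opprB.
  have K2s : (K2 ^t*)%sesqui = - K2.
    apply/matrixP => i j; rewrite !mxE rmorphM rmorphD fmorphV rmorphM /= conjCK
      conjC_nat conjCi.
    by field; rewrite i0.
  clearbody K1 K2.
  pose KP := map_mx polyC K1 + 'X *: map_mx polyC K2.
  pose P := (1%:M - KP) *m \adj (1%:M + KP).
  have KPE t : map_mx (horner_eval t) KP = K1 + t *: K2.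
    by apply/matrixP => i j; rewrite !mxE /horner_eval !hornerE.
  have PE t : map_mx (horner_eval t) P =
      (1%:M - (K1 + t *: K2)) *m \adj (1%:M + (K1 + t *: K2)).
    by rewrite map_mxM map_mx_adj map_mxB (map_mxD _ 1%:M) map_mx1 KPE.
  rewrite -Kc -PE; apply: tcomm_poly => m; rewrite PE.
  set Km := K1 + _; have Kms : (Km ^t*)%sesqui = - Km.
    by rewrite /Km linearD linearZ /= map_mxD map_mxZ rmorph_nat K1s K2s scalerN -opprD.
  have uP := skew_unit Kms; have dP : \det (1%:M + Km) != 0 by rewrite -unitfE.
  have := AU _ (cayley_unitary Kms); rewrite -/(tcomm A _) /invmx uP -scalemxAr.
  by apply: tcommZ; rewrite invr_eq0.
(* The Cayley transform is an involution, so [X] is the transform of its own transform [K]. *)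
have tcomm_unit X : 1%:M + X \in unitmx -> tcomm A X.
  move=> uX; pose K := (1%:M - X) *m invmx (1%:M + X).
  have two0 : 2 != 0 :> C by rewrite pnatr_eq0.
  have KP : 1%:M + K = 2 *: invmx (1%:M + X).
    rewrite /K -{1}(mulmxV uX) -mulmxDl addrACA subrr addr0.
    by rewrite -mulr2n -scaler_nat -scalemxAl mul1mx.
  have KN : 1%:M - K = 2 *: (X *m invmx (1%:M + X)).
    rewrite /K -{1}(mulmxV uX) -mulmxBl opprB addrC addrA subrK.
    by rewrite -mulr2n -scaler_nat -scalemxAl.
  have uK : 1%:M + K \in unitmx.
    by rewrite KP unitmxZ ?unitfE // unitmx_inv.
  have dK : \det (1%:M + K) != 0 by rewrite -unitfE.
  have := tcomm_adj K.
  have -> : (1%:M - K) *m \adj (1%:M + K) = \det (1%:M + K) *: X.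
    have <- : X *m (1%:M + K) = 1%:M - K by rewrite KP KN -scalemxAr.
    by rewrite -mulmxA mul_mx_adj mul_mx_scalar.
  exact: tcommZ.
(* A nonzero [m] with [1 + m X] invertible suffices; the factor ['X] of the polynomial excludes
   [m = 0]. *)
move=> X; have [m] : exists m : nat,
    ('X * \det (1%:M + 'X *: map_mx polyC X)).[m%:R] != 0.
  apply: poly_nat_nonroot; rewrite mulf_eq0 polyX_eq0 /=.
  apply/eqP => /(congr1 (horner_eval 0)); rewrite -det_map_mx map_mxD map_mx1.
  have -> : map_mx (horner_eval 0) ('X *: map_mx polyC X) = 0.
    by apply/matrixP => i j; rewrite !mxE /horner_eval !hornerE.
  by rewrite addr0 det1 /horner_eval horner0 => /eqP; rewrite oner_eq0.
rewrite hornerM hornerX mulf_eq0 negb_or => /andP[m0].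
rewrite -horner_evalE -det_map_mx map_mxD map_mx1.
have -> : map_mx (horner_eval m%:R) ('X *: map_mx polyC X) = m%:R *: X.
  by apply/matrixP => i j; rewrite !mxE /horner_eval !hornerE.
by move=> dX; apply: (tcommZ m0); apply: tcomm_unit; rewrite unitmxE unitfE.
Qed.
Definition rank_one_fun (w : tensor) (g : idx) (t : tensor) : tensor := t g *: w.

Fact rank_one_fun_linear w g : linear (rank_one_fun w g).
Proof.
by move=> a x y; rewrite /rank_one_fun !ffunE scalerDl scalerA.
Qed.
HB.instance Definition _ w g :=
  GRing.isLinear.Build C tensor tensor _ (rank_one_fun w g) (rank_one_fun_linear w g).

Definition rank_one w g : 'End(tensor) := linfun (rank_one_fun w g).

Lemma rank_oneE w g t : rank_one w g t = t g *: w.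
Proof. by rewrite lfunE. Qed.

Lemma lfun_sum_rank_one (D : 'End(tensor)) :
  D = \sum_f \sum_g D (ebase g) f *: rank_one (ebase f) g.
Proof.
apply: lfun_ebase_eq => g; rewrite sum_lfunE [LHS]tensor_sum_ebase.
apply: eq_bigr => f _; rewrite sum_lfunE (bigD1 g) //= big1 ?addr0 => [|g' gg'].
  by rewrite scale_lfunE rank_oneE !ffunE eqxx scale1r.
by rewrite scale_lfunE rank_oneE !ffunE (negPf gg') scale0r scaler0.
Qed.

(** Up to the factor [n!], the projection onto the operators commuting with all permutations. *)
Definition average (D : 'End(tensor)) : 'End(tensor) :=
  (\sum_(s : 'S_n) (tens_perm C l s^-1 \o D \o tens_perm C l s))%VF.

Lemma natr_eq_ffun (u v : idx) : (u == v)%:R = \prod_k (u k == v k)%:R :> C.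
Proof.
have [->|/eqP uv] := eqVneq u v; first by rewrite big1 // => k _; rewrite eqxx.
have [k /negPf uvk] : exists k, u k != v k.
  apply: contrapT => all_eq; apply: uv; apply/ffunP => k; apply/eqP.
  by apply: contrapT => /negP uvk; apply: all_eq; exists k.
by rewrite (bigD1 k) //= uvk mul0r.
Qed.

(** Polarization: the entries of the average are permanents, and Ryser's formula writes them through
    tensor powers of matrices, with which every element of [CnU] commutes. *)
Lemma average_rank_one f g :
  average (rank_one (ebase f) g) = (-1) ^+ n *:
    \sum_(S : {set 'I_n}) (-1) ^+ #|S| *:
      tens_mx n (\sum_(j in S) delta_mx (f j) (g j)).
Proof.
apply: lfun_ebase_eq => h'; apply/ffunP => h.
rewrite scale_lfunE ffunE !sum_lfunE !sum_ffunE.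
under [X in _ = _ *: X]eq_bigr => S _.
  rewrite scale_lfunE ffunE tens_mx_ebase.
  under eq_bigr => k _ do rewrite summxE.
over.
rewrite /GRing.scale /=.
rewrite (perm_sum_prod (fun j k => delta_mx (f j) (g j) (h k) (h' k))).
rewrite mulrA -exprD addnn -signr_odd odd_double mul1r.
apply: eq_bigr => s _; rewrite !comp_lfunE rank_oneE linearZ /= ffunE.
rewrite !lfunE /= !ffunE /GRing.scale /=.
under eq_bigr => k _ do rewrite mxE -mulnb natrM.
rewrite big_split /= mulrC; congr (_ * _).
  rewrite natr_eq_ffun (reindex_inj (@perm_inj _ s)).
  by apply: eq_bigr => k _; rewrite ffunE permK.
by rewrite natr_eq_ffun; apply: eq_bigr => k _; rewrite ffunE eq_sym.
Qed.

Lemma comp_average A D : CnU A -> (A \o average D = average D \o A)%VF.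
Proof.
move=> AU.
have comm_rank_one f g :
    (A \o average (rank_one (ebase f) g) = average (rank_one (ebase f) g) \o A)%VF.
  rewrite average_rank_one -comp_lfunZl -comp_lfunZr; congr (_ *: _).
  rewrite comp_lfun_suml comp_lfun_sumr; apply: eq_bigr => S _.
  by rewrite -comp_lfunZl -comp_lfunZr; congr (_ *: _); apply: tcomm_all.
have -> : average D =
    \sum_f \sum_g D (ebase g) f *: average (rank_one (ebase f) g).
  rewrite {1}(lfun_sum_rank_one D) /average.
  under eq_bigr => s _.
    rewrite comp_lfun_sumr comp_lfun_suml.
    under eq_bigr => f _.
      rewrite comp_lfun_sumr comp_lfun_suml.
      under eq_bigr => g _ do rewrite -comp_lfunZr -comp_lfunZl.
    over.
  over.
  rewrite exchange_big; apply: eq_bigr => f _.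
  rewrite exchange_big; apply: eq_bigr => g _.
  by rewrite scaler_sumr.
rewrite comp_lfun_suml comp_lfun_sumr; apply: eq_bigr => f _.
rewrite comp_lfun_suml comp_lfun_sumr; apply: eq_bigr => g _.
by rewrite -comp_lfunZl -comp_lfunZr comm_rank_one.
Qed.

Lemma Tl_sum (I : finType) (P : pred I) (F : I -> grpalg C n) :
  Tl l (\sum_(i | P i) F i) = \sum_(i | P i) Tl l (F i).
Proof. exact: linear_sum. Qed.

Lemma TlZ k (a : grpalg C n) : Tl l (k *: a) = k *: Tl l a.
Proof. exact: linearZ. Qed.

(* Double centralizer: [P] averages a linear projection onto the image of the
   group algebra, so that [P A = A \o P 1] for every [A] commuting with averages. *)
Theorem schur_weyl A : CnU A -> exists a : grpalg C n, A = Tl l a.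
Proof.
move=> AU; pose T := linfun (@Tl C l n); have TE a : T a = Tl l a by rewrite lfunE.
move: T TE => T TE; pose P0 := projv (limg T).
pose P Y := \sum_(s : 'S_n) (tens_perm C l s^-1 \o P0 (tens_perm C l s \o Y))%VF.
(* [D k g] records how column [k] of [P0 Y] depends on column [g] of [Y]. *)
pose D k g := \sum_f rank_one (P0 (rank_one (ebase f) g) (ebase k)) f.
have P0E Y k : P0 Y (ebase k) = \sum_g D k g (Y (ebase g)).
  rewrite {1}(lfun_sum_rank_one Y) linear_sum sum_lfunE.
  rewrite [RHS](eq_bigr (fun g => \sum_f Y (ebase g) f *:
      P0 (rank_one (ebase f) g) (ebase k))) => [|g _]; last first.
    by rewrite sum_lfunE; apply: eq_bigr => f _; rewrite rank_oneE.
  rewrite [RHS]exchange_big; apply: eq_bigr => f _.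
  rewrite linear_sum sum_lfunE; apply: eq_bigr => g _.
  by rewrite linearZ scale_lfunE.
have PE Y k : P Y (ebase k) = \sum_g average (D k g) (Y (ebase g)).
  rewrite sum_lfunE; under eq_bigr => s _.
    rewrite comp_lfunE P0E linear_sum.
    under eq_bigr => g _ do rewrite comp_lfunE.
  over.
  rewrite exchange_big; apply: eq_bigr => g _; rewrite sum_lfunE.
  by apply: eq_bigr => s _; rewrite !comp_lfunE.
(* By [PE], [P] is built from averages, and [A] commutes with each of them. *)
have PA : P A = (A \o P \1)%VF.
  apply: lfun_ebase_eq => k; rewrite comp_lfunE !PE linear_sum; apply: eq_bigr => g _.
  have /lfunP/(_ (ebase g)) := comp_average (D k g) AU.
  by rewrite !comp_lfunE id_lfunE => e.
(* [P0] fixes the permutation operators, so each of the [n!] summands is the identity. *)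
have P1 : P \1%VF = n`!%:R *: \1%VF.
  rewrite /P (eq_bigr (fun=> \1%VF)) => [|s _]; last first.
    rewrite comp_lfun1r projv_id ?tens_perm_comp ?mulgV -?Tl_perm ?Tl1 //.
    by rewrite -TE memv_img ?memvf.
  by rewrite sumr_const card_Sn scaler_nat.
have PB Y : exists a : grpalg C n, P Y = Tl l a.
  have /= P0T s := memv_imgP (memv_proj (limg T) (tens_perm C l s \o Y)%VF).
  have [b bP] := fin_all_exists (fun s => let: ex_intro2 b _ e := P0T s in ex_intro _ b e).
  exists (\sum_s gperm C (s^-1)%g * b s); rewrite Tl_sum /P; apply: eq_bigr => s _.
  by rewrite TlM Tl_perm /P0 bP TE.
have [a aE] := PB A; exists (n`!%:R^-1 *: a).
rewrite TlZ -aE PA P1 -comp_lfunZr comp_lfun1r scalerA mulVf ?scale1r //.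
by rewrite pnatr_eq0 -lt0n fact_gt0.
Qed.
End SchurWeyl.

(** * Young symmetrizers *)

Section YoungCharacter.
Variables (C : numFieldType) (n : nat).
Implicit Types (p q s : 'S_n) (A B : {set 'I_n}).

Definition preserves A p := forall k, (p k \in A) = (k \in A).

Lemma restr_perm_if A p : preserves A p ->
  forall k, restr_perm A p k = if k \in A then p k else k.
Proof.
move=> Ap k; case: ifPn => kA; last exact: out_perm (restr_perm_on _ _) kA.
by rewrite restr_permE //; apply/astabsP => j; rewrite /= apermE Ap.
Qed.

(** The sign of the permutation induced on [A] when [p] preserves [A]; otherwise the restriction is
    trivial and the value is 1. *)
Definition sign_on A p : C := (-1) ^+ restr_perm A p.

Lemma sign_onM A p q : preserves A p -> preserves A q ->
  sign_on A (p * q)%g = sign_on A p * sign_on A q.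
Proof.
move=> Ap Aq; rewrite /sign_on -signr_addb -odd_permM; congr (_ ^+ odd_perm _).
have Apq : preserves A (p * q)%g by move=> j; rewrite permM Aq Ap.
apply/permP => k; rewrite permM (restr_perm_if Ap) (restr_perm_if Aq).
by rewrite (restr_perm_if Apq); case: ifP => kA; rewrite ?Ap kA ?permM.
Qed.

Lemma sign_on_sqr A p : sign_on A p * sign_on A p = 1.
Proof. by rewrite /sign_on -signr_addb addbb. Qed.

Lemma sign_on_id A p : (forall k, k \in A -> p k = k) -> sign_on A p = 1.
Proof.
move=> Ap; have presA : preserves A p.
  move=> k; apply/idP/idP => [pkA|kA]; last by rewrite Ap.
  by have := Ap _ pkA => /perm_inj <-.
rewrite /sign_on (_ : restr_perm A p = 1%g) ?odd_perm1 //.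
by apply/permP => k; rewrite restr_perm_if // perm1; case: ifP => // /Ap.
Qed.

Lemma sign_on_perm_on A p : perm_on A p -> sign_on A p = (-1) ^+ p.
Proof.
move=> Ap; congr (_ ^+ odd_perm _); apply/permP => k.
rewrite restr_perm_if => [|j]; last exact: perm_closed.
by case: ifPn => // kA; rewrite (out_perm Ap).
Qed.

Lemma sign_onV A p : preserves A p -> sign_on A p^-1%g = sign_on A p.
Proof.
move=> Ap; have ApV : preserves A p^-1%g by move=> k; rewrite -Ap permKV.
rewrite -[LHS]mulr1 -(sign_on_sqr A p) mulrA -sign_onM // mulVg.
by rewrite sign_on_id ?mul1r // => k _; rewrite perm1.
Qed.

Lemma eq_sign_on A B p : preserves A p -> preserves B p ->
  (forall k, (k \in A) != (k \in B) -> p k = k) -> sign_on A p = sign_on B p.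
Proof.
move=> Ap Bp AB; congr (_ ^+ odd_perm _); apply/permP => k.
rewrite !restr_perm_if //; have := AB k.
by case: (k \in A); case: (k \in B) => //= ->.
Qed.

Lemma sign_onJ A B p s : preserves A p -> (forall k, (s k \in B) = (k \in A)) ->
  sign_on B (p ^ s)%g = sign_on A p.
Proof.
move=> Ap sAB; rewrite /sign_on -[in RHS](odd_permJ _ s).
congr (_ ^+ odd_perm _); apply/permP => k.
have [j ->] : exists j, k = s j by exists ((s^-1)%g k); rewrite permKV.
rewrite permJ !restr_perm_if //; last first.
  move=> i; have [j' ->] : exists j', i = s j' by exists ((s^-1)%g i); rewrite permKV.
  by rewrite permJ !sAB Ap.
by rewrite sAB; case: ifP => _; rewrite ?permJ.
Qed.

End YoungCharacter.

Section GroupAlgebraFactors.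
Variables (C : numFieldType) (n : nat).
Implicit Types (p q s : 'S_n) (S : {set 'I_n}).

Lemma gpermM p q : gperm C p * gperm C q = gperm C (q * p)%g.
Proof. exact: gmul_perm. Qed.

Definition eps (e : bool) p : C := if e then (-1) ^+ p else 1.

Lemma epsM e p q : eps e (p * q)%g = eps e p * eps e q.
Proof. by case: e; rewrite /eps ?mulr1 // odd_permM signr_addb. Qed.

Lemma eps_sqr e p : eps e p * eps e p = 1.
Proof. by case: e; rewrite /eps ?mulr1 // -signr_addb addbb. Qed.

Lemma epsJ e p q : eps e (p ^ q)%g = eps e p.
Proof. by rewrite /eps odd_permJ. Qed.

(** A common form of [gE] and [gH], so that both kinds of blocks share their proofs. *)
Definition gX (e : bool) S : grpalg C n :=
  \sum_(s | perm_on S s) eps e s *: gperm C s.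

Lemma gX_true S : gX true S = gE C S. Proof. by []. Qed.

Lemma gX_false S : gX false S = gH C S.
Proof. by apply: eq_bigr => s _; rewrite scale1r. Qed.

Lemma perm_onMr S p q : perm_on S p -> perm_on S (q * p)%g = perm_on S q.
Proof.
move=> Sp; apply/idP/idP => [Sqp|Sq]; last exact: perm_onM.
by rewrite -(mulgK p q) perm_onM // perm_onV.
Qed.

Lemma perm_onJ S p q : preserves S p -> perm_on S (q ^ p)%g = perm_on S q.
Proof.
move=> Sp; apply/fintype.subsetP/fintype.subsetP => Sq k; rewrite inE => qk.
  by rewrite -Sp; apply: Sq; rewrite inE permJ (inj_eq (@perm_inj _ p)).
have [j kj] : exists j, k = p j by exists ((p^-1)%g k); rewrite permKV.
move: qk; rewrite kj permJ (inj_eq (@perm_inj _ p)) => qj.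
by rewrite Sp; apply: Sq; rewrite inE.
Qed.

Lemma gperm_gX_comm e S p : preserves S p -> GRing.comm (gperm C p) (gX e S).
Proof.
move=> Sp; rewrite /GRing.comm mulr_sumr mulr_suml.
rewrite [RHS](reindex_inj (conjg_inj p)); apply: eq_big => [s|s _].
  by rewrite perm_onJ.
by rewrite -scalerAr -scalerAl !gpermM epsJ conjgC.
Qed.

Lemma gperm_gX e S p : perm_on S p -> gperm C p * gX e S = eps e p *: gX e S.
Proof.
move=> Sp; rewrite mulr_sumr scaler_sumr.
rewrite [RHS](reindex_inj (mulIg p)); apply: eq_big => [s|s _].
  by rewrite perm_onMr.
by rewrite -scalerAr gpermM scalerA epsM mulrCA eps_sqr mulr1.
Qed.

(** [p] commutes past the factors preceding [F i], and [F i] then turns it into the scalar [a]. *)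
Lemma gperm_prod_absorb (I : eqType) (r : seq I) (P : pred I) (F : I -> grpalg C n)
    p a i : i \in r -> P i -> gperm C p * F i = a *: F i ->
  (forall j, P j -> GRing.comm (gperm C p) (F j)) ->
  gperm C p * \prod_(j <- r | P j) F j = a *: \prod_(j <- r | P j) F j.
Proof.
move=> ir Pi pFi pF; elim: r ir => // j r IH.
rewrite inE big_cons; have [<- _|ij /= ir] := eqVneq i j.
  by rewrite Pi mulrA pFi scalerAl.
by case: ifP => Pj; rewrite ?IH // mulrA pF // -mulrA IH // scalerAr.
Qed.

End GroupAlgebraFactors.

Section YoungSymmetrizer.
Variables (C : numFieldType) (n : nat) (W : set nat) (nu : seq nat).
Hypothesis sum_nu : sumn nu = n.
Implicit Types (p q s : 'S_n).

Definition blk (k : 'I_n) : nat := reshape_index nu k.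

Lemma mem_block k i : (k \in block n nu i) = (blk k == i).
Proof.
have k_lt : (k < sumn nu)%N by rewrite sum_nu.
have take_succ j : (j < size nu)%N ->
    sumn (take j.+1 nu) = (sumn (take j nu) + nth 0 nu j)%N.
  by move=> js; rewrite (take_nth 0) // sumn_rcons.
rewrite inE; apply/andP/eqP => [[ik ki]|<-]; last first.
  have := reshape_offsetP k_lt; have := reshape_indexK nu k.
  by rewrite take_succ ?reshape_indexP // /flatten_index /blk; lia.
have i_lt : (i < size nu)%N.
  rewrite ltnNge; apply/negP => si; move: ik ki; rewrite !take_oversize ?(leqW si) //.
  by move=> /leq_ltn_trans/[apply]; rewrite ltnn.
rewrite take_succ // in ki; rewrite /blk -(subnKC ik).
by apply: flatten_indexKl; rewrite ltn_subLR.
Qed.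

Lemma blk_lt_size k : (blk k < size nu)%N.
Proof. by apply: reshape_indexP; rewrite sum_nu. Qed.

Lemma card_block i : #|[set k | blk k == i]| = nth 0 nu i.
Proof.
have [i_lt|si] := ltnP i (size nu); last first.
  rewrite nth_default //; apply/eqP; rewrite cards_eq0; apply/eqP/setP => k.
  rewrite !inE; apply: contraTF (blk_lt_size k) => /eqP ->.
  by rewrite -leqNgt.
have sum_i : (sumn (take i nu) + nth 0 nu i <= n)%N.
  rewrite -sumn_rcons -take_nth // -[X in (_ <= X)%N]sum_nu.
  by rewrite -[in X in (_ <= X)%N](cat_take_drop i.+1 nu) sumn_cat leq_addr.
transitivity (\sum_(sumn (take i nu) <= k < sumn (take i.+1 nu)) 1)%N; last first.
  by rewrite sum_nat_const_nat muln1 (take_nth 0) // sumn_rcons addKn.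
rewrite (big_nat_widenl _ 0) // (big_nat_widen _ _ n) /=; last first.
  by rewrite (take_nth 0) // sumn_rcons.
by rewrite big_mkord -sum1_card; apply: eq_bigl => k; rewrite inE -mem_block inE.
Qed.

Definition young p : bool := [forall k, blk (p k) == blk k].

Definition wset : {set 'I_n} := [set k | blk k \in W].

Lemma in_wset k : (k \in wset) = (blk k \in W).
Proof. exact: finset.in_set. Qed.

(** On the Young subgroup, the linear character that is the sign on the blocks indexed by [W] and
    trivial on the others. *)
Definition chi p : C := sign_on C wset p.

Lemma youngP p : reflect (forall k, blk (p k) = blk k) (young p).
Proof. exact: 'forall_eqP. Qed.

Lemma youngM p q : young p -> young q -> young (p * q)%g.
Proof.
by move=> /youngP Yp /youngP Yq; apply/youngP => k; rewrite permM Yq Yp.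
Qed.

Lemma youngV p : young p -> young p^-1%g.
Proof. by move=> /youngP Yp; apply/youngP => k; rewrite -Yp permKV. Qed.

Lemma young_tperm a c : blk a = blk c -> young (tperm a c).
Proof. by move=> ac; apply/youngP => k; case: tpermP => [->|->|]. Qed.

Lemma young_wset p : young p -> preserves wset p.
Proof. by move=> /youngP Yp k; rewrite !inE Yp. Qed.

Lemma young_block p i : young p -> preserves (block n nu i) p.
Proof. by move=> /youngP Yp k; rewrite !mem_block Yp. Qed.

Lemma perm_on_block_young p i : perm_on (block n nu i) p -> young p.
Proof.
move=> ip; apply/youngP => k; have [ki|ki] := boolP (k \in block n nu i).
  have := ki; rewrite -(perm_closed _ ip) !mem_block => /eqP ->.
  by move: ki; rewrite mem_block => /eqP ->.
by rewrite (out_perm ip).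
Qed.

Lemma chiM p q : young p -> young q -> chi (p * q)%g = chi p * chi q.
Proof. by move=> Yp Yq; apply: sign_onM; apply: young_wset. Qed.

Lemma chi_sqr p : chi p * chi p = 1.
Proof. exact: sign_on_sqr. Qed.

Lemma chi_perm_on_block p i : perm_on (block n nu i) p -> chi p = eps C (i \in W) p.
Proof.
move=> ip; rewrite /eps; case: ifPn => iW.
  apply/sign_on_perm_on/fintype.subsetP => k /(fintype.subsetP ip).
  by rewrite mem_block inE => /eqP ->.
apply: sign_on_id => k; rewrite inE => kW; apply: (out_perm ip).
by rewrite mem_block; apply: contraNneq iW => <-.
Qed.

Notation Pi := (gPi C n W nu).

Definition factor (i : nat) : grpalg C n := gX C (i \in W) (block n nu i).

Lemma gPiE : Pi = (\prod_(i < size nu | (i : nat) \in W) factor i) *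
                  (\prod_(i < size nu | (i : nat) \notin W) factor i).
Proof.
congr (_ * _); apply: eq_bigr => i iW; rewrite /factor.
  by rewrite iW gX_true.
by rewrite (negPf iW) gX_false.
Qed.

Lemma gPi_comm p : young p -> GRing.comm (gperm C p) Pi.
Proof.
move=> Yp; rewrite gPiE; apply: commrM; apply: commr_prod => i _;
  exact/gperm_gX_comm/young_block.
Qed.

Lemma tperm_on_block a c : blk a = blk c -> perm_on (block n nu (blk a)) (tperm a c).
Proof.
move=> ac; apply/fintype.subsetP => k; rewrite inE mem_block.
by case: tpermP => [-> _|-> _|_ _ /eqP//]; rewrite ?ac eqxx.
Qed.

Lemma chi_tperm a c : a != c -> blk a = blk c ->
  chi (tperm a c) = if blk a \in W then -1 else 1.
Proof.
move=> ac bac; rewrite (chi_perm_on_block (tperm_on_block bac)) /eps odd_tperm ac.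
by case: ifP.
Qed.

(** The transposition lives in a single block: the factor of that block absorbs it and the other
    factors commute with it. *)
Lemma tperm_gPi a c : blk a = blk c ->
  gperm C (tperm a c) * Pi = chi (tperm a c) *: Pi.
Proof.
move=> ac; set t := tperm a c.
have Yt : young t by apply: young_tperm.
have t_on : perm_on (block n nu (blk a)) t by apply: tperm_on_block.
have t_factor : gperm C t * factor (blk a) = chi t *: factor (blk a).
  by rewrite (chi_perm_on_block t_on) gperm_gX.
have t_comm (j : 'I_(size nu)) : GRing.comm (gperm C t) (factor j).
  exact/gperm_gX_comm/young_block.
rewrite gPiE; have [aW|aW] := boolP (blk a \in W).
  rewrite mulrA (gperm_prod_absorb (a := chi t) (i := Ordinal (blk_lt_size a)))
    ?mem_index_enum //.
  by rewrite scalerAl.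
have comm_W : GRing.comm (gperm C t)
    (\prod_(i < size nu | (i : nat) \in W) factor i) by apply: commr_prod.
rewrite mulrA comm_W -mulrA.
rewrite (gperm_prod_absorb (a := chi t) (i := Ordinal (blk_lt_size a)))
    ?mem_index_enum //.
by rewrite scalerAr.
Qed.

(** Induction on the number of moved points: composing [p] with the transposition of [a] and [p a]
    fixes [a] and stays in the Young subgroup. *)
Lemma gperm_gPi p : young p -> gperm C p * Pi = chi p *: Pi.
Proof.
have [m] := ubnP #|[set k | p k != k]|; elim: m p => // m IH p pm Yp.
have [/forallP p1|] := boolP [forall k, p k == k].
  have -> : p = 1%g by apply/permP => k; rewrite perm1; apply/eqP.
  by rewrite [LHS]mul1r /chi sign_on_id ?scale1r // => k _; rewrite perm1.
rewrite negb_forall => /existsP[a pa]; pose t := tperm a (p a); pose q := (p * t)%g.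
have Ya : blk a = blk (p a) by have /youngP -> := Yp.
have Yt : young t by apply: young_tperm.
have pE : p = (q * t)%g by rewrite /q -mulgA tperm2 mulg1.
have Yq : young q by apply: youngM.
have qm : (#|[set k | q k != k]| < m)%N.
  rewrite -ltnS; apply: leq_trans pm; rewrite ltnS; apply: proper_card.
  apply/properP; split.
    apply/fintype.subsetP => k; rewrite !inE permM; apply: contraNN => /eqP pk.
    have ak : a != k by apply: contraNneq pa => ->; rewrite pk.
    by rewrite pk tpermD // -[X in _ != X]pk (inj_eq (@perm_inj _ p)).
  by exists a; rewrite !inE ?pa // permM tpermR eqxx.
by rewrite pE -gpermM -mulrA IH // -scalerAr tperm_gPi // scalerA chiM.
Qed.

Lemma gPi_gperm p : young p -> Pi * gperm C p = chi p *: Pi.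
Proof. by move=> Yp; rewrite -gPi_comm // gperm_gPi. Qed.

Definition ysum : grpalg C n := \sum_(p | young p) chi p *: gperm C p.

Lemma youngMr p q : young p -> young (q * p)%g = young q.
Proof.
move=> Yp; apply/idP/idP => [Yqp|Yq]; last exact: youngM.
by rewrite -(mulgK p q) youngM // youngV.
Qed.

Lemma gperm_ysum p : young p -> gperm C p * ysum = chi p *: ysum.
Proof.
move=> Yp; rewrite mulr_sumr scaler_sumr.
rewrite [RHS](reindex_inj (mulIg p)); apply: eq_big => [s|s Ys].
  by rewrite youngMr.
by rewrite -scalerAr gpermM scalerA chiM // mulrCA chi_sqr mulr1.
Qed.

(** [Pi * ysum] is computed twice: factor by factor it is a positive multiple of [ysum], and term by
    term it is the order of the Young subgroup times [Pi]. *)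
Lemma gPi_ysum : exists2 c : C, c != 0 & Pi = c *: ysum.
Proof.
pose eigen (x : grpalg C n) := exists2 m : nat, (0 < m)%N & x * ysum = m%:R *: ysum.
have eigen1 : eigen 1 by exists 1 => //; rewrite mul1r scale1r.
have eigenM x y : eigen x -> eigen y -> eigen (x * y).
  move=> [m m0 xm] [m' m0' ym]; exists (m' * m)%N; first by rewrite muln_gt0 m0'.
  by rewrite -mulrA ym -scalerAr xm scalerA natrM.
have eigen_factor i : eigen (factor i).
  exists #|[set s | perm_on (block n nu i) s]|.
    by apply/card_gt0P; exists 1%g; rewrite inE perm_on1.
  rewrite mulr_suml -sum1_card natr_sum scaler_suml big_mkcond [RHS]big_mkcond.
  apply: eq_bigr => s _; rewrite inE; case: ifP => // s_on.
  rewrite -scalerAl gperm_ysum ?(perm_on_block_young s_on) // scalerA.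
  by rewrite -(chi_perm_on_block s_on) chi_sqr.
have [m m0 Pim] : eigen Pi.
  by rewrite gPiE; apply: (@eigenM _ _); apply: (big_ind eigen eigen1 eigenM) => i _;
    apply: eigen_factor.
have Y0 : #|[set p | young p]|%:R != 0 :> C.
  rewrite pnatr_eq0 -lt0n; apply/card_gt0P; exists 1%g.
  by rewrite inE; apply/youngP => k; rewrite perm1.
have PiY : Pi * ysum = #|[set p | young p]|%:R *: Pi.
  rewrite mulr_sumr -sum1_card natr_sum scaler_suml big_mkcond [RHS]big_mkcond.
  apply: eq_bigr => s _; rewrite inE; case: ifP => // Ys.
  by rewrite -scalerAr gPi_gperm // scalerA chi_sqr.
exists (#|[set p | young p]|%:R^-1 * m%:R).
  by rewrite mulf_neq0 ?invr_eq0 // pnatr_eq0 -lt0n.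
by rewrite -scalerA -Pim PiY scalerA mulVf ?scale1r.
Qed.

End YoungSymmetrizer.

(** * Straightening *)

Lemma eq_opp_eq0 (C : numFieldType) (V : lmodType C) (x : V) : x = - x -> x = 0.
Proof.
move/eqP; rewrite -addr_eq0 -mulr2n -scaler_nat scaler_eq0 pnatr_eq0 /=.
by move/eqP.
Qed.

(** Pigeonhole: a basis index [h] takes the same value at two positions of [S], and reindexing by
    their transposition negates the sum. *)
Lemma Tl_gE_eq0 (C : numClosedFieldType) (l n : nat) (S : {set 'I_n}) :
  (l < #|S|)%N -> Tl l (gE C S) = 0.
Proof.
move=> lS; apply/lfunP => t; apply/ffunP => h; rewrite zero_lfunE [RHS]ffunE.
have [a [c [aS cS ac hac]]] : exists a c, [/\ a \in S, c \in S, a != c & h a = h c].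
  apply: contrapT => h_inj; move: lS; rewrite ltnNge => /negP; apply.
  rewrite -[l]card_ord -(card_in_imset (f := h)) ?max_card // => a c aS cS hac.
  by apply: contrapT => /eqP ac; apply: h_inj; exists a, c.
have perm_t : perm_on S (tperm a c).
  apply/fintype.subsetP => k; rewrite inE.
  by case: tpermP => [->|->|_ _ /eqP//].
have TlE : Tl l (gE C S) t h = \sum_(s | perm_on S s) (-1) ^+ s * t [ffun k => h (s k)].
  rewrite Tl_sum sum_lfunE sum_ffunE; apply: eq_bigr => s _.
  by rewrite TlZ Tl_perm scale_lfunE ffunE /tens_perm lfunE /= ffunE.
apply: (@eq_opp_eq0 C C^o); rewrite TlE -sumrN.
rewrite [LHS](reindex_inj (mulIg (tperm a c))); apply: eq_big => [s|s _].
  by rewrite perm_onMr.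
rewrite odd_permM odd_tperm ac addbT signrN mulNr; congr (- (_ * t _)).
by apply/ffunP => k; rewrite !ffunE permM; case: tpermP => // ->.
Qed.

(** * Double cosets of Young subgroups and their multisets *)

Section DoubleCosets.
Variables (C : numFieldType) (n : nat) (W W' : set nat) (nu nu' : seq nat).
Hypotheses (sum_nu : sumn nu = n) (sum_nu' : sumn nu' = n).
Implicit Types (p q s t : 'S_n).

Definition dcoset s : grpalg C n := gPi C n W' nu' * gperm C s * gPi C n W nu.

Definition cell s (k : 'I_n) : nat * nat := (blk nu k, blk nu' (s k)).

Lemma cell1 s k : (cell s k).1 = blk nu k. Proof. by []. Qed.

Lemma cell2 s k : (cell s k).2 = blk nu' (s k). Proof. by []. Qed.

Definition mset_of s : {mset nat * nat} := seq_mset [seq cell s k | k <- enum 'I_n].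

Definition weight s : nat := (\sum_k blk nu k * blk nu' (s k))%N.

Lemma dcosetM p s q : young nu p -> young nu' q ->
  dcoset (p * s * q)%g = (chi C W' nu' q * chi C W nu p) *: dcoset s.
Proof.
move=> Yp Yq; rewrite /dcoset.
have := gPi_gperm C W' sum_nu' Yq; have := gperm_gPi C W sum_nu Yp.
move: (gPi C n W' nu') (gPi C n W nu) => X Y pY Xq.
rewrite -gpermM -(gpermM C s p) !mulrA Xq -!mulrA pY.
by rewrite -!scalerAl -!scalerAr scalerA mulrA.
Qed.

Lemma mset_ofE s v : mset_of s v = #|[set k | cell s k == v]|.
Proof. by rewrite mset_seqE count_mem_codom. Qed.

Lemma representsP s M : represents nu nu' s M <-> mset_of s = M.
Proof.
have cellE i j : #|[set k in block n nu i | s k \in block n nu' j]| = mset_of s (i, j).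
  rewrite mset_ofE; apply: eq_card => k.
  by rewrite [LHS]inE (mem_block sum_nu) (mem_block sum_nu') [RHS]inE.
split=> [rM|<- i j]; last by rewrite cellE.
by apply/msetP => -[i j]; rewrite rM cellE.
Qed.

Lemma cell_double_coset p s q k : young nu p -> young nu' q ->
  cell (p * s * q)%g k = cell s (p k).
Proof. by move=> /youngP Yp /youngP Yq; rewrite /cell !permM Yp Yq. Qed.

Lemma mset_of_double_coset p s q : young nu p -> young nu' q ->
  mset_of (p * s * q)%g = mset_of s.
Proof.
move=> Yp Yq; apply/msetP => v; rewrite !mset_ofE.
rewrite -!sum1_card [RHS](reindex_inj (@perm_inj _ p)) /=.
by apply: eq_bigl => k; rewrite !inE cell_double_coset.
Qed.

Lemma weight_double_coset p s q : young nu p -> young nu' q ->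
  weight (p * s * q)%g = weight s.
Proof.
move=> Yp Yq; rewrite /weight [RHS](reindex_inj (@perm_inj _ p)) /=.
by apply: eq_bigr => k _; have [-> ->] := cell_double_coset s k Yp Yq.
Qed.

(** A matching [a] of cells places [t] in the double coset of [s], through
    [t = a s (s^-1 a^-1 t)]. *)
Lemma cell_perm s t (a : 'S_n) : (forall k, cell s (a k) = cell t k) ->
  young nu a /\ young nu' (s^-1 * a^-1 * t)%g.
Proof.
move=> ast; split; apply/youngP => k; first by have [] := ast k.
rewrite !permM; set j := (a^-1 _)%g; have -> : k = s (a j) by rewrite /j !permKV.
by have [_] := ast j.
Qed.

Lemma eq_mset_of_double_coset s t : mset_of s = mset_of t ->
  exists p q, [/\ young nu p, young nu' q & t = (p * s * q)%g].
Proof.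
move=> st; have [v|a /cell_perm[Ya Yq]] := @exists_perm_fibers _ _ (cell s) (cell t).
  by rewrite -!mset_ofE st.
by exists a, (s^-1 * a^-1 * t)%g; split=> //; rewrite !mulgA mulgK mulgV mul1g.
Qed.

Lemma eq_mset_of_dcoset s t : mset_of s = mset_of t ->
  exists c : C, dcoset s = c *: dcoset t.
Proof.
move=> /esym/eq_mset_of_double_coset[p [q [Yp Yq ->]]].
by rewrite dcosetM //; eexists.
Qed.

Lemma msetsU_mset_of s : compatible W W' (mset_of s) -> msetsU W W' nu nu' (mset_of s).
Proof.
move=> comp_s; split=> // i; rewrite (seq.permP (perm_eq_seq_mset _)) count_map.
  rewrite -(card_block sum_nu) -sum1_count big_enum_cond /= -sum1_card.
  by apply: eq_bigl => k; rewrite !inE.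
rewrite -(card_block sum_nu') -sum1_count big_enum_cond /= -sum1_card.
rewrite [RHS](reindex_inj (@perm_inj _ s)) /=.
by apply: eq_bigl => k; rewrite !inE.
Qed.

Lemma compatible_cellP s : compatible W W' (mset_of s) <->
  forall a c, cell s a = cell s c ->
    (blk nu a \in W) (+) (blk nu' (s a) \in W') -> a = c.
Proof.
split=> [comp_s a c ac /comp_s|comp_s i j ij].
  rewrite mset_ofE => /card_le1_eqP; apply; rewrite inE //.
  by rewrite -ac.
rewrite mset_ofE; apply/card_le1_eqP => a c; rewrite !inE => /eqP ai /eqP ci.
by apply: comp_s; [rewrite ai ci|case: ci => -> ->].
Qed.

(** Two positions share a cell whose indices have different types. Their transposition, moved across
    [s], is absorbed with sign [-1] on one side and [1] on the other. *)
Lemma dcoset_incompatible s : ~ compatible W W' (mset_of s) -> dcoset s = 0.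
Proof.
move=> ncomp; have [a [c [ac cell_ac Wa]]] : exists a c,
    [/\ a != c, cell s a = cell s c & (blk nu a \in W) (+) (blk nu' (s a) \in W')].
  apply: contrapT => nac; apply: ncomp; apply/compatible_cellP => a c cell_ac Wa.
  by apply: contrapT => /eqP ac; apply: nac; exists a, c.
have [blk_ac blk'_ac] := cell_ac.
have Yt := young_tperm blk_ac; have Yt' := young_tperm blk'_ac.
have Y1 : young nu (1%g : 'S_n) by apply/youngP => k; rewrite perm1.
have Y1' : young nu' (1%g : 'S_n) by apply/youngP => k; rewrite perm1.
have chi1 : chi C W nu (1%g : 'S_n) = 1 by apply: sign_on_id => k _; rewrite perm1.
have chi1' : chi C W' nu' (1%g : 'S_n) = 1 by apply: sign_on_id => k _; rewrite perm1.
have := dcosetM s Yt Y1'.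
have -> : (tperm a c * s * 1 = 1 * s * tperm (s a) (s c))%g.
  by rewrite mulg1 mul1g conjgC tpermJ.
rewrite (dcosetM s Y1 Yt') chi1 chi1' mulr1 mul1r.
rewrite !chi_tperm // ?(inj_eq (@perm_inj _ s)) //.
move: Wa; case: (_ \in W); case: (_ \in W') => //= _; rewrite scale1r scaleN1r.
  exact: eq_opp_eq0.
by move=> /esym; apply: eq_opp_eq0.
Qed.

End DoubleCosets.

(** * The decreasing relation on cells *)

Section Decreasing.
Variables (W W' : set nat).

Lemma decr_trans : transitive (decr W W').
Proof.
move=> q p r /and4P[pq1 qp2 pqW pqW'] /and4P[qr1 rq2 qrW qrW'].
apply/and4P; split; first exact: leq_trans qr1.
- exact: leq_trans qp2.
- apply/implyP => /eqP pr; apply: (implyP pqW).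
  by rewrite eqn_leq pq1 pr.
- apply/implyP => /eqP pr; apply: (implyP pqW').
  by rewrite eqn_leq qp2 pr rq2.
Qed.

Lemma not_decrP p q : ~~ decr W W' p q -> (p.1 < q.1)%N -> (p.2 <= q.2)%N.
Proof.
move=> npq pq; rewrite leqNgt; apply: contraNN npq => qp.
by rewrite /decr (ltnW pq) (ltnW qp) (ltn_eqF pq) eq_sym (ltn_eqF qp).
Qed.

(** With a common first coordinate in [W], the second coordinates decide comparability, unless they
    coincide outside [W']. *)
Lemma not_decr_eq1 p q : ~~ decr W W' p q -> ~~ decr W W' q p -> p.1 = q.1 ->
  p.1 \in W -> p = q /\ p.2 \notin W'.
Proof.
case: p q => [x y] [x' y'] /= npq nqp e xW; subst x'; move: npq nqp.
rewrite /decr /= leqnn eqxx xW /=.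
by case: (ltngtP y y') => //= <-; case: (y \in W').
Qed.

Lemma not_decr_eq2 p q : ~~ decr W W' p q -> ~~ decr W W' q p -> p.2 = q.2 ->
  p.2 \in W' -> p = q /\ p.1 \notin W.
Proof.
case: p q => [x y] [x' y'] /= npq nqp e yW; subst y'; move: npq nqp.
rewrite /decr /= leqnn eqxx yW /= !andbT.
by case: (ltngtP x x') => //= <-; case: (x \in W).
Qed.

End Decreasing.

Section Straightening.
Variables (C : numClosedFieldType) (l n : nat) (W W' : set nat) (nu nu' : seq nat).
Hypotheses (sum_nu : sumn nu = n) (sum_nu' : sumn nu' = n).
Implicit Types (p q s t : 'S_n).

Notation dcoset s := (dcoset C W W' nu nu' s).
Notation weight := (weight nu nu').
Notation cell := (cell nu nu').
Notation mset_of := (mset_of nu nu').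

(** A chain with more than [l] terms lifts to distinct positions, pairwise comparable by
    transitivity. *)
Lemma decr_seq_positions s : (l < ellminus W W' (mset_of s))%N ->
  exists2 S : {set 'I_n}, (l < #|S|)%N & {in S &, forall a c, a != c ->
    decr W W' (cell s a) (cell s c) || decr W W' (cell s c) (cell s a)}.
Proof.
move=> l_lt; have [t t_decr lt] : exists2 t, decr_seq_of W W' (mset_of s) t & (l < size t)%N.
  apply: contrapT => no_t; move: l_lt; rewrite ltnNge => /negP; apply.
  apply/bigmax_leqP => k /asboolP[t t_decr <-]; rewrite leqNgt.
  by apply/negP => lt; apply: no_t; exists t.
case/andP: t_decr => t_sorted /msubsetP t_sub.
have [v|r r_uniq rt] := @uniq_lift_seq _ _ (cell s) t.
  by rewrite -mset_ofE -mset_seqE.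
exists [set k in r] => [|a c].
  by rewrite cardsE (card_uniqP r_uniq) -(size_map (cell s)) rt.
have r_sorted : pairwise (relpre (cell s) (decr W W')) r.
  by rewrite -pairwise_map rt -sorted_pairwise //; apply: decr_trans.
rewrite !inE => ar cr ac.
have := pairwiseP a r_sorted => /= r_decr.
have [ic|ci|ii] := ltngtP (index a r) (index c r).
- by have := r_decr _ _ _ _ ic; rewrite !inE !index_mem !nth_index // => ->.
- by have := r_decr _ _ _ _ ci; rewrite !inE !index_mem !nth_index // => ->; rewrite ?orbT.
- by move: ac; rewrite -(nth_index a ar) ii nth_index ?eqxx.
Qed.

(** On [S] the two block indices are oppositely ordered, so permuting [S] cannot lower the weight.
    In case of equality the term stays in the double coset of [s], and the correcting permutations
    move points only inside blocks of [W] or [W'], so all signs cancel. *)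
Lemma straighten_term s (S : {set 'I_n}) sg :
  {in S &, forall a c, a != c ->
    decr W W' (cell s a) (cell s c) || decr W W' (cell s c) (cell s a)} ->
  perm_on S sg ->
  (weight s < weight (sg * s)%g)%N \/ (-1) ^+ sg *: dcoset (sg * s)%g = dcoset s.
Proof.
(* Reversing the second index gives the common ordering that [rearrangement] requires. *)
move=> S_decr sgS; pose x := @blk n nu; pose y k := (size nu' - blk nu' (s k))%N.
have yK k : (y k + blk nu' (s k) = size nu')%N by rewrite subnK // ltnW // blk_lt_size.
(* [S] is one colour class, and every other position, being fixed by [sg], is a class of its own. *)
pose c k := if k \in S then None else Some k.
have c_sg k : c (sg k) = c k.
  by rewrite /c (perm_closed _ sgS); case: ifPn => // kS; rewrite (out_perm sgS).
have cosorted k k' : c k = c k' -> (x k < x k' -> y k <= y k')%N.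
  rewrite /c; case: ifPn => kS; case: ifPn => k'S //; last by case=> ->; rewrite ltnn.
  move=> _ xk; rewrite leq_sub2l //.
  have kk' : k != k' by apply: contraTneq xk => ->; rewrite ltnn.
  have /orP[/and4P[_]//|/and4P[/=]] := S_decr _ _ kS k'S kk'.
  by rewrite leqNgt xk.
have weightE t : (weight (t * s)%g + \sum_k x k * y (t k) = \sum_k x k * size nu')%N.
  by rewrite -big_split /=; apply: eq_bigr => k _; rewrite -mulnDr permM addnC yK.
have weight1 : (weight s + \sum_k x k * y k = \sum_k x k * size nu')%N.
  by rewrite -[s in LHS]mul1g -(weightE 1%g); under [in RHS]eq_bigr do rewrite perm1.
have le_sum := rearrangement cosorted c_sg.
have [lt|ge] := ltnP (weight s) (weight (sg * s)%g); [by left|right].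
have eq_sum : (\sum_k x k * y (sg k) = \sum_k x k * y k)%N.
  by have := weightE sg; move: weight1 le_sum ge; lia.
have [a aP] := rearrangement_eq cosorted c_sg eq_sum.
have a_x k : blk nu (a k) = blk nu k by have [] := aP k.
have a_y k : blk nu' (s (sg (a k))) = blk nu' (s k).
  by have [_ _ ya] := aP k; have := yK (sg (a k)); have := yK k; rewrite ya; lia.
have aS : perm_on S a.
  apply/fintype.subsetP => k; rewrite inE; apply: contraNT => kS.
  by have [] := aP k; rewrite /c (negPf kS); case: ifP => // _ [->].
have cell_a k : cell (sg * s)%g (a k) = cell s k.
  by rewrite /cell a_x permM a_y.
have [Ya Yq] := cell_perm cell_a.
set q := (_ * _ * s)%g in Yq.
have sE : s = (a * (sg * s) * q)%g by rewrite /q -invMg mulKVg.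
clearbody q.
(* Comparable positions in one block of [nu] force this block into [W], so [chi] is the full sign of
   [a]; likewise for [q] and [W']. *)
have chi_a : chi C W nu a = (-1) ^+ a.
  apply/sign_on_perm_on/fintype.subsetP => k ak; rewrite in_wset.
  have {}ak : a k != k := ak.
  have kS : k \in S by apply: (fintype.subsetP aS); rewrite inE.
  have := S_decr _ _ _ kS ak; rewrite (perm_closed _ aS) => /(_ kS).
  by case/orP=> /and4P[_ _ + _]; rewrite !cell1 a_x eqxx /= => ->.
have agS : perm_on S (a * sg)%g by apply: perm_onM.
have q_s k : q (s (sg (a k))) = s k by rewrite [in RHS]sE !permM.
have chi_q : chi C W' nu' q = (-1) ^+ q.
  apply/sign_on_perm_on/fintype.subsetP => j qj; rewrite in_wset.
  have {}qj : q j != j := qj; move: qj.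
  have [i ->] : exists i, j = s (sg (a i)).
    by exists ((a^-1)%g ((sg^-1)%g ((s^-1)%g j))); rewrite !permKV.
  rewrite q_s a_y (inj_eq (@perm_inj _ s)) eq_sym => i_moved.
  have iS : i \in S by apply: (fintype.subsetP agS); rewrite inE permM.
  have := S_decr _ _ _ iS i_moved.
  rewrite (perm_closed _ sgS) (perm_closed _ aS) => /(_ iS).
  by case/orP=> /and4P[_ _ _]; rewrite !cell2 a_y eqxx /= => ->.
have sign_sq : (-1) ^+ (sg : bool) = (-1) ^+ q * (-1) ^+ a :> C.
  have := congr1 (@odd_perm _) sE; rewrite !odd_permM -signr_addb.
  by do 4! case: (odd_perm _).
by rewrite [in RHS]sE dcosetM // chi_a chi_q sign_sq.
Qed.

Notation T s := (Tl l (dcoset s)).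

(** The vanishing sum of [s E_S] is split by weight; [m] counts the terms that are not heavier, all
    equal to [T s]. *)
Lemma straighten s : (l < ellminus W W' (mset_of s))%N ->
  exists2 m : nat, (0 < m)%N & exists a : 'S_n -> C,
    m%:R *: T s = \sum_(t | (weight s < weight t)%N) a t *: T t.
Proof.
move=> /decr_seq_positions[S lS S_decr].
have sum0 : \sum_(sg | perm_on S sg) (-1) ^+ sg *: T (sg * s)%g = 0.
  transitivity (Tl l (gPi C n W' nu' * (gperm C s * gE C S) * gPi C n W nu)).
    rewrite mulr_sumr mulr_sumr mulr_suml Tl_sum; apply: eq_bigr => sg _.
    by rewrite -!scalerAr -scalerAl TlZ gpermM.
  by rewrite !TlM Tl_gE_eq0 // comp_lfun0r comp_lfun0r comp_lfun0l.
pose gt sg := (weight s < weight (sg * s)%g)%N.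
exists #|[set sg | perm_on S sg && ~~ gt sg]|.
  by apply/card_gt0P; exists 1%g; rewrite inE perm_on1 /gt mul1g ltnn.
(* Coefficients after the substitution [t = sg * s]. *)
exists (fun t => if perm_on S (t * s^-1)%g then - (-1) ^+ (t * s^-1)%g else 0).
move: sum0; rewrite (bigID gt) /= addrC => /eqP; rewrite addr_eq0 => /eqP sum0.
rewrite -sum1_card natr_sum scaler_suml.
transitivity (\sum_(sg | perm_on S sg && ~~ gt sg) (-1) ^+ sg *: T (sg * s)%g).
  apply: eq_big => [sg|sg]; first by rewrite inE.
  rewrite inE scale1r => /andP[sgS ngt].
  by have [gt_sg|<-] := straighten_term S_decr sgS; [rewrite /gt gt_sg in ngt|rewrite TlZ].
rewrite sum0 -sumrN big_mkcond [RHS](reindex_inj (mulIg s)) [RHS]big_mkcond /=.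
apply: eq_bigr => sg _; rewrite mulgK /gt.
by case: (perm_on S sg); case: (_ < _)%N; rewrite //= ?scale0r ?scaleNr.
Qed.

(** Induction on [B - weight s]: incompatible multisets give zero, and long chains lead to strictly
    heavier terms. *)
Lemma straightening (U : {vspace 'End(tensor C l n)}) :
  (forall s, compatible W W' (mset_of s) -> (ellminus W W' (mset_of s) <= l)%N ->
    T s \in U) -> forall s, T s \in U.
Proof.
move=> good_U s; pose B := (\max_(t : 'S_n) weight t)%N.
have [m] := ubnP (B - weight s); elim: m s => // m IH s sm.
have [comp_s|] := pselect (compatible W W' (mset_of s)); last first.
  by move=> /(dcoset_incompatible C sum_nu sum_nu') ->; rewrite -(scale0r 0) TlZ scale0r mem0v.
have [/(good_U _ comp_s) //|/straighten[k k0 [a sumE]]] :=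
  leqP (ellminus W W' (mset_of s)) l.
have kC : k%:R != 0 :> C by rewrite pnatr_eq0 -lt0n.
rewrite -[T s](scalerK kC) sumE memvZ // memv_suml // => t st.
have tB : (weight t <= B)%N by apply: leq_bigmax.
by rewrite memvZ // IH //; lia.
Qed.

End Straightening.

(** * Linear independence *)

Section TriangularFamilies.
Variables (C : numClosedFieldType) (l n : nat).

(** In a vanishing combination, choose an index of least weight with nonzero coefficient: at its
    entry [(u, h)] no other term survives. *)
Lemma triangular_free (I : eqType) (r : seq I) (F : I -> 'End(tensor C l n))
    (weight : I -> nat) :
  uniq r ->
  (forall i, i \in r -> exists u h, F i u h != 0 /\
     forall j, j \in r -> j != i -> F j u h != 0 -> (weight j < weight i)%N) ->
  free (map F r).
Proof.
move=> r_uniq tri; apply/(freeP (X := map_tuple F (in_tuple r))) => a sum0 i.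
apply/eqP; apply: contraT => ai0.
pose w j := weight (tnth (in_tuple r) j).
have [j aj0 j_min] := arg_minnP (P := fun j => a j != 0) w ai0.
have [u [h [Fj0 Fj]]] := tri _ (mem_tnth j (in_tuple r)).
have := congr1 (fun B : 'End(tensor C l n) => B u h) sum0.
rewrite /= sum_lfunE sum_ffunE zero_lfunE [RHS]ffunE (bigD1 j) //=.
have FE (k : 'I_(size r)) : (map F r)`_k = F (tnth (in_tuple r) k).
  rewrite (nth_map (tnth (in_tuple r) k)) //; congr F.
  by rewrite [RHS](tnth_nth (tnth (in_tuple r) k)).
rewrite big1 ?addr0 => [|k kj].
  rewrite scale_lfunE ffunE FE /GRing.scale /= => /eqP.
  by rewrite mulf_eq0 (negPf aj0) (negPf Fj0).
rewrite scale_lfunE ffunE FE /GRing.scale /=; apply/eqP; rewrite mulf_eq0.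
apply: contraT; rewrite negb_or => /andP[ak0 Fk0].
have kj' : tnth (in_tuple r) k != tnth (in_tuple r) j.
  have /tuple_uniqP r_inj : uniq (in_tuple r) := r_uniq.
  by rewrite (inj_eq r_inj).
have := Fj _ (mem_tnth k (in_tuple r)) kj' Fk0.
by rewrite ltnNge -/(w j) -/(w k) j_min.
Qed.

End TriangularFamilies.

Section Independence.
Variables (C : numClosedFieldType) (l n : nat) (W W' : set nat) (nu nu' : seq nat).
Hypotheses (sum_nu : sumn nu = n) (sum_nu' : sumn nu' = n).
Implicit Types (p q s t : 'S_n).

Notation dcoset s := (dcoset C W W' nu nu' s).
Notation weight := (weight nu nu').
Notation cell := (cell nu nu').
Notation mset_of := (mset_of nu nu').
Notation T s := (Tl l (dcoset s)).

Lemma decr_coloring s : (ellminus W W' (mset_of s) <= l)%N ->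
  exists f : 'I_n -> 'I_l, forall k k', k != k' -> f k = f k' ->
    ~~ decr W W' (cell s k) (cell s k').
Proof.
move=> short; pose d k k' := decr W W' (cell s k) (cell s k').
(* [d] can hold both ways, for positions in the same cell; breaking ties by position yields a strict
   order. *)
pose r k k' := d k k' && (~~ d k' k || (k < k')%N).
have d_trans : transitive d by move=> k1 k2 k3; apply: decr_trans.
have r_trans : transitive r.
  move=> k2 k1 k3 /andP[d12 o12] /andP[d23 o23]; rewrite /r (d_trans _ _ _ d12 d23) /=.
  have [d31|//] := boolP (d k3 k1).
  move: o12 o23; rewrite (d_trans _ _ _ d23 d31) (d_trans _ _ _ d31 d12) /=.
  exact: ltn_trans.
have r_irr : irreflexive r by move=> k; rewrite /r ltnn; case: (d k k).
have [t t_sorted|f fl fr] := @antichain_coloring n r l.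
  apply: leq_trans short; rewrite -(size_map (cell s)); apply: leq_ellminus.
  apply/andP; split.
    by rewrite sorted_map; apply: sub_sorted t_sorted => k k' /andP[].
  apply/msubsetP => v; rewrite mset_seqE mset_ofE card_lift_seq //.
  exact: sorted_uniq t_sorted.
exists (fun k => Ordinal (fl k)) => k k' kk' /(congr1 val) /= fkk'.
apply/negP => dkk'.
have [dk'k|ndk'k] := boolP (d k' k); last first.
  by have := fr k k'; rewrite /r /d dkk' ndk'k fkk' ltnn => /(_ isT).
case: (ltngtP k k') => [lt|gt|/val_inj eq_kk'].
- by have := fr k k'; rewrite /r /d dkk' lt orbT fkk' ltnn => /(_ isT).
- by have := fr k' k; rewrite /r dk'k gt orbT fkk' ltnn => /(_ isT).
- by rewrite eq_kk' eqxx in kk'.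
Qed.

(** * Matrix entries attached to a colouring *)

Section Coloring.
Variables (s0 : 'S_n) (f : {ffun 'I_n -> 'I_l}).
Hypothesis compatible_s0 : compatible W W' (mset_of s0).
Hypothesis f_color : forall k k', k != k' -> f k = f k' ->
  ~~ decr W W' (cell s0 k) (cell s0 k').

Definition target_color : {ffun 'I_n -> 'I_l} := [ffun k => f ((s0^-1)%g k)].

Definition color_match t : bool := [forall k, f ((s0^-1)%g (t k)) == f k].

(** In a block of [W], two incomparable positions would share a cell with second index outside [W'],
    which compatibility forbids. *)
Lemma same_color_notin1 k k' : k != k' -> f k = f k' -> blk nu k = blk nu k' ->
  blk nu k \notin W.
Proof.
move=> kk' fkk' b_kk'; apply/negP => kW.
have ndkk' := f_color kk' fkk'.
have ndk'k := f_color (k := k') (k' := k); rewrite eq_sym kk' fkk' in ndk'k.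
have [cell_eq yW'] := not_decr_eq1 ndkk' (ndk'k isT erefl) b_kk' kW.
have := (compatible_cellP _ _ _ _ _).1 compatible_s0 _ _ cell_eq.
rewrite kW -[blk nu' (s0 k)]/(cell s0 k).2 (negPf yW') => /(_ isT) eq_kk'.
by rewrite eq_kk' eqxx in kk'.
Qed.

Lemma same_color_notin2 k k' : k != k' -> f k = f k' ->
  blk nu' (s0 k) = blk nu' (s0 k') -> blk nu' (s0 k) \notin W'.
Proof.
move=> kk' fkk' b_kk'; apply/negP => kW.
have ndkk' := f_color kk' fkk'.
have ndk'k := f_color (k := k') (k' := k); rewrite eq_sym kk' fkk' in ndk'k.
have [cell_eq xW] := not_decr_eq2 ndkk' (ndk'k isT erefl) b_kk' kW.
have := (compatible_cellP _ _ _ _ _).1 compatible_s0 _ _ cell_eq.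
rewrite kW -[blk nu k]/(cell s0 k).1 (negPf xW) => /(_ isT) eq_kk'.
by rewrite eq_kk' eqxx in kk'.
Qed.

(** A match means that [t * s0^-1] preserves colours, and inside a colour the cells of [s0] are
    weakly increasing, so the rearrangement lemmas apply. *)
Lemma color_match_weight t : color_match t ->
  (weight t <= weight s0)%N /\ (weight t = weight s0 ->
    exists a : 'S_n, forall k, f (a k) = f k /\ cell t (a k) = cell s0 k).
Proof.
move=> /'forall_eqP ft; pose sg := (t * s0^-1)%g.
have sgE k : s0 (sg k) = t k by rewrite permM permKV.
pose x := @blk n nu; pose y k := blk nu' (s0 k).
have cosorted k k' : f k = f k' -> (x k < x k' -> y k <= y k')%N.
  move=> fkk' lt; have kk' : k != k' by apply: contraTneq lt => ->; rewrite ltnn.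
  exact: (not_decrP (f_color kk' fkk') lt).
have f_sg k : f (sg k) = f k by rewrite permM ft.
have weightE : (\sum_k x k * y (sg k) = weight t)%N.
  by apply: eq_bigr => k _; rewrite /y sgE.
have := rearrangement cosorted f_sg; have := rearrangement_eq cosorted f_sg.
rewrite weightE => eq_case le_case; split=> // /eq_case[a aP]; exists a => k.
have [fa xa ya] := aP k; split=> //.
by rewrite /cell -/x xa -sgE -/(y _) ya.
Qed.

(** [q] is the conjugate of [p^-1] by [s0], so both characters are signs of [p] on sets of
    positions. Where these sets differ, compatibility makes [p] fix the point. *)
Lemma chi_stabilizer p q : young nu p -> young nu' q -> (p * s0 * q = s0)%g ->
  chi C W' nu' q * chi C W nu p = 1.
Proof.
move=> Yp Yq pq.
pose A' := [set k | s0 k \in wset n W' nu'] : {set 'I_n}.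
have A'E k : (k \in A') = (s0 k \in wset n W' nu') by rewrite finset.in_set.
have s0p k : q (s0 (p k)) = s0 k by rewrite -[in RHS]pq !permM.
have y_p k : blk nu' (s0 (p k)) = blk nu' (s0 k).
  by rewrite -(youngP _ _ Yq (s0 (p k))) s0p.
have A'p : preserves A' p by move=> k; rewrite !A'E !in_wset y_p.
have A'pV : preserves A' p^-1%g by move=> k; rewrite -A'p permKV.
have qE : q = (p^-1 ^ s0)%g 
  by apply: (mulgI (p * s0)%g); rewrite pq conjgE !mulgA mulgK mulgV mul1g.
have -> : chi C W' nu' q = sign_on C A' p.
  rewrite /chi qE (@sign_onJ _ _ A') //; first exact: sign_onV.
rewrite /chi (@eq_sign_on _ _ A' (wset n W nu)) //; first exact: sign_on_sqr.
  exact: young_wset.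
move=> k; rewrite A'E !in_wset => kW.
have cell_pk : cell s0 k = cell s0 (p k).
  by rewrite /cell y_p (youngP _ _ Yp).
apply/esym/((compatible_cellP _ _ _ _ _).1 compatible_s0 _ _ cell_pk).
by move: kW; case: (_ \in W); case: (_ \in W').
Qed.

(** The equality case gives [a] and [b] of trivial character with [a t b = s0], which reduces the
    claim to [chi_stabilizer]. *)
Lemma color_match_sign p q : young nu p -> young nu' q ->
  color_match (p * s0 * q)%g -> chi C W' nu' q * chi C W nu p = 1.
Proof.
move=> Yp Yq; have wt := weight_double_coset s0 Yp Yq.
move tE : (p * s0 * q)%g wt => t wt match_t.
have [_ /(_ wt)[a aP]] := color_match_weight match_t.
have [fa cell_a] : (forall k, f (a k) = f k) /\ (forall k, cell t (a k) = cell s0 k).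
  by split=> k; have [] := aP k.
have [Ya Yb] := cell_perm cell_a.
move bE : (t^-1 * a^-1 * s0)%g Yb => b Yb.
have b_ta k : b (t (a k)) = s0 k by rewrite -bE !permM !permK.
(* [a] preserves colours and blocks, so by [same_color_notin1] it fixes every position in a block of
   [W]. *)
have chi_a : chi C W nu a = 1.
  apply: sign_on_id => k; rewrite in_wset => kW; apply/eqP; apply: contraTT kW => ak.
  rewrite eq_sym in ak; apply: same_color_notin1 ak _ _; first by rewrite fa.
  by rewrite (youngP _ _ Ya).
have chi_b : chi C W' nu' b = 1.
  apply: sign_on_id => j.
  have [k ->] : exists k, j = t (a k).
    by exists ((a^-1)%g ((t^-1)%g j)); rewrite !permKV.
  rewrite in_wset b_ta => jW; apply/eqP; apply: contraTT jW => ne.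
  pose k' := (s0^-1)%g (t (a k)); have k'E : s0 k' = t (a k) by rewrite /k' permKV.
  rewrite -k'E in ne *; rewrite (inj_eq (@perm_inj _ s0)) eq_sym in ne.
  apply: same_color_notin2 ne _ _.
    by rewrite /k' ('forall_eqP match_t) fa.
  by rewrite k'E; have [_] := cell_a k.
have := chi_stabilizer (youngM Ya Yp) (youngM Yq Yb).
rewrite !chiM // chi_a chi_b mul1r mulr1; apply.
have -> : (a * p * s0 * (q * b) = a * t * b)%g by rewrite -tE !mulgA.
by apply/permP => k; rewrite !permM b_ta.
Qed.

Lemma Tl_gperm_entry t :
  Tl l (gperm C t) (ebase C f) target_color = (color_match t)%:R.
Proof.
rewrite Tl_perm /tens_perm lfunE /= !ffunE; congr (_%:R); congr nat_of_bool.
apply/eqP/'forall_eqP => [/ffunP eq_f k|eq_f].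
  by have := eq_f k; rewrite !ffunE.
by apply/ffunP => k; rewrite !ffunE.
Qed.

Lemma dcoset_entry : exists2 c : C, c != 0 & forall s,
  T s (ebase C f) target_color = c *
    \sum_(q | young nu' q) \sum_(p | young nu p)
      (chi C W' nu' q * chi C W nu p) * (color_match (p * s * q)%g)%:R.
Proof.
have [c c0 PiE] := gPi_ysum C W sum_nu; have [c' c'0 PiE'] := gPi_ysum C W' sum_nu'.
exists (c' * c); first by rewrite mulf_neq0.
move=> s; rewrite -[dcoset s]/(gPi C n W' nu' * gperm C s * gPi C n W nu) PiE PiE'.
have -> : (c' *: ysum C n W' nu') * gperm C s * (c *: ysum C n W nu) =
    (c' * c) *: \sum_(q | young nu' q) \sum_(p | young nu p)
      (chi C W' nu' q * chi C W nu p) *: gperm C (p * s * q)%g.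
  rewrite -!scalerAl -scalerAr scalerA !mulr_suml; congr (_ *: _).
  apply: eq_bigr => q _; rewrite mulr_sumr; apply: eq_bigr => p _.
  by rewrite -!scalerAl -scalerAr scalerA !gpermM mulgA.
rewrite TlZ scale_lfunE ffunE Tl_sum sum_lfunE sum_ffunE /GRing.scale /=.
congr (_ * _); apply: eq_bigr => q _; rewrite Tl_sum sum_lfunE sum_ffunE.
apply: eq_bigr => p _.
by rewrite TlZ scale_lfunE ffunE Tl_gperm_entry.
Qed.

(** At [s0] every matching term has sign [+1] and the identity pair matches, so nothing cancels.
    Elsewhere a match bounds the weight, and equal weight would force equal multisets. *)
Lemma entry_triangular_of_coloring : exists u h, T s0 u h != 0 /\
  forall s, T s u h != 0 -> mset_of s != mset_of s0 -> (weight s < weight s0)%N.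
Proof.
have [c c0 entryE] := dcoset_entry.
exists (ebase C f), target_color; split=> [|s].
  rewrite entryE mulf_neq0 //.
  pose m := (\sum_(q | young nu' q) \sum_(p | young nu p) color_match (p * s0 * q)%g)%N.
  rewrite (_ : \sum_(q | _) _ = m%:R).
    have young1 mu : young mu (1%g : 'S_n) by apply/youngP => k; rewrite perm1.
    have match1 : color_match (1 * s0 * 1)%g.
      by rewrite mul1g mulg1; apply/forallP => k; rewrite permK.
    by rewrite pnatr_eq0 /m (bigD1 1%g) //= (bigD1 1%g) //= match1.
  rewrite /m natr_sum; apply: eq_bigr => q Yq.
  rewrite natr_sum; apply: eq_bigr => p Yp.
  by case: (boolP (color_match _)) => [/color_match_sign ->|]; rewrite ?mulr0 ?mulr1.
rewrite entryE mulf_eq0 (negPf c0) /= => sum_n0 ne_mset.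
have [p [q [Yp Yq match_t]]] : exists p q,
    [/\ young nu p, young nu' q & color_match (p * s * q)%g].
  apply: contrapT => no_match; move/eqP: sum_n0; apply.
  rewrite big1 // => q Yq; rewrite big1 // => p Yp.
  case: (boolP (color_match _)) => [match_t|]; last by rewrite mulr0.
  by case: no_match; exists p, q.
have [] := color_match_weight match_t; rewrite weight_double_coset //.
rewrite leq_eqVlt => /orP[/eqP eq_w|//] /(_ eq_w)[a aP].
case/eqP: ne_mset; rewrite -(mset_of_double_coset s Yp Yq).
apply/msetP => v; rewrite !mset_ofE -!sum1_card (reindex_inj (@perm_inj _ a)) /=.
by apply: eq_bigl => k; rewrite !finset.in_set; have [_ ->] := aP k.
Qed.

End Coloring.

Lemma entry_triangular s0 : compatible W W' (mset_of s0) ->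
  (ellminus W W' (mset_of s0) <= l)%N ->
  exists u h, T s0 u h != 0 /\
    forall s, T s u h != 0 -> mset_of s != mset_of s0 -> (weight s < weight s0)%N.
Proof.
move=> comp_s0 /decr_coloring[f f_color].
apply: (@entry_triangular_of_coloring s0 (finfun f)) => // k k' kk'.
by rewrite !ffunE; apply: f_color.
Qed.

End Independence.

(** * Assembly of independence and spanning *)

Lemma span_mapP (K : fieldType) (V : vectType K) (A : lmodType K) (F : A -> V)
    (I : eqType) (g : I -> A) (r : seq I) v :
  linear F -> v \in <<map (F \o g) r>>%VS -> exists a, v = F a.
Proof.
move=> F_lin; elim: r v => [|i r IH] v.
  rewrite span_nil memv0 => /eqP ->; exists 0.
  by have := F_lin (-1) 0 0; rewrite scaler0 addr0 scaleN1r addNr.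
rewrite span_cons => /memv_addP[_ /vlineP[k ->] [u /IH[a ->] ->]].
by exists (k *: g i + a); rewrite F_lin.
Qed.

Lemma Tl_sandwich_linear (C : numClosedFieldType) (l n : nat) (x y : grpalg C n) :
  linear (fun a => Tl l (x * a * y)).
Proof.
move=> k a b; rewrite mulrDr mulrDl -scalerAr -scalerAl.
exact: Tl_linear.
Qed.

Theorem theorem8p4 (R : realType) (W W' : set nat) (l n : nat)
    (nu nu' : seq nat) (hnu : sumn nu = n) (hnu' : sumn nu' = n)
    (pi : {mset nat * nat} -> 'S_n)
    (hpi : forall M, msetsU W W' nu nu' M -> represents nu nu' (pi M) M) :
  is_basis (fun M => msetsU W W' nu nu' M /\ (ellminus W W' M <= l)%N)
           (fun M => Tl_mset R[i] l W W' nu nu' (pi M))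
           (PiCnUPi (C := R[i]) (l := l) (n := n) W W' nu nu').
Proof.
have mset_of_pi M : msetsU W W' nu nu' M -> mset_of nu nu' (pi M) = M.
  by move=> /hpi /(representsP hnu hnu').
have compatibleM M : msetsU W W' nu nu' M -> compatible W W' M by case.
split=> [r r_uniq rP|B].
  apply: (triangular_free (weight := fun M => weight nu nu' (pi M))) => // M rM.
  have [MU Ml] := rP M rM.
  have [||u [h [M0 Mlt]]] := @entry_triangular R[i] l n W W' nu nu' hnu hnu' (pi M).
  - by rewrite mset_of_pi //; apply: compatibleM.
  - by rewrite mset_of_pi.
  exists u, h; split=> // M' rM' MM' M'0; apply: Mlt => //.
  by have [M'U _] := rP M' rM'; rewrite !mset_of_pi.
pose F (a : grpalg R[i] n) := Tl l (gPi R[i] n W' nu' * a * gPi R[i] n W nu).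
have F_linear : linear F.
  exact: Tl_sandwich_linear.
split=> [[A /schur_weyl[a ->] ->]|[r rP]]; last first.
  move=> /(span_mapP (g := fun M => gperm R[i] (pi M)) F_linear)[a ->].
  by exists (Tl l a); [apply: Tl_CnU|rewrite /F !TlM].
pose good M := msetsU W W' nu nu' M /\ (ellminus W W' M <= l)%N.
(* Running over all permutations gives a finite list containing every multiset that straightening
   can produce. *)
pose r := [seq M <- [seq mset_of nu nu' s | s <- enum 'S_n] | `[< good M >]].
exists r => [M|]; first by rewrite mem_filter => /andP[/asboolP].
have F_in s : Tl l (dcoset R[i] W W' nu nu' s) \in
    <<map (fun M => Tl_mset R[i] l W W' nu nu' (pi M)) r>>%VS.
  apply: (straightening hnu hnu') => {}s comp_s short_s.
  have sU := msetsU_mset_of hnu hnu' comp_s.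
  (* Replacing [s] by the chosen representative of its multiset costs only a scalar. *)
  have [c ->] := eq_mset_of_dcoset R[i] W W' hnu hnu' (esym (mset_of_pi _ sU)).
  rewrite TlZ memvZ // memv_span //; apply/mapP; exists (mset_of nu nu' s) => //.
  rewrite mem_filter; apply/andP; split; first exact/asboolP.
  by apply: map_f; rewrite mem_enum.
rewrite -!TlM -/(F a) (gpermE a).
have -> : F (\sum_s a s *: gperm R[i] s) = \sum_s a s *: F (gperm R[i] s).
  rewrite /F mulr_sumr mulr_suml Tl_sum; apply: eq_bigr => s _.
  by rewrite -scalerAr -scalerAl TlZ.
by apply: memv_suml => s _; rewrite memvZ //; apply: F_in.
Qed.
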